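(* Let $I=[\tfrac12,1]\cup\{\infty\}$ and let $\nu$ be the probability measure on $I$ given by $\nu(dx)=\frac{dx}{2x^2}$ for $\tfrac12<x<1$ and $\nu(\{\infty\})=\tfrac12$. Any invariant recursive tree process with marginal $\nu$ associated with the recursive distributional equation $$Y\overset{d}{=}\Phi(Y_1\wedge Y_2;U)\quad\text{on } I$$ has trivial tail. Here $Y_1,Y_2$ are i.i.d. with the same law as $Y$ and independent of $U\sim\mathrm{Uniform}[0,1]$, and $\Phi:I\times[0,1]\to I$ is defined by $\Phi(x;u)=x$ if $x>u$ and $\Phi(x;u)=\infty$ otherwise.
   Context: The notation $a\wedge b$ means $\min(a,b)$, with $\infty$ larger than every real number. The measure $\nu$ is a solution of the distributional equation $Y\overset{d}{=}\Phi(Y_1\wedge Y_2;U)$ on $I$, where $Y_1,Y_2$ are i.i.d. with the same law as $Y$ and independent of $U\sim\mathrm{Uniform}[0,1]$. Let $\widetilde{\mathcal V}=\{\emptyset\}\cup\bigcup_{d\ge1}\{1,2\}^d$ be the vertex set of the rooted binary tree (finite words over $\{1,2\}$), with $|\mathbf i|$ the length of the word $\mathbf i$ and $\mathbf i j$ the word obtained by appending $j$ to $\mathbf i$. Let $(U_{\mathbf i})_{\mathbf i\in\widetilde{\mathcal V}}$ be i.i.d. $\mathrm{Uniform}[0,1]$ random variables (the innovation process). An invariant recursive tree process with marginal $\nu$ associated with the recursive distributional equation $Y\overset{d}{=}\Phi(Y_1\wedge Y_2;U)$ on $I$ is a process $(Y_{\mathbf i})_{\mathbf i\in\widetilde{\mathcal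 V}}$ of $I$-valued random variables, defined jointly with $(U_{\mathbf i})$, such that: (i) $Y_{\mathbf i}\sim\nu$ for all $\mathbf i$; (ii) for each $d\ge0$ the variables $(Y_{\mathbf i})_{|\mathbf i|=d}$ are independent; (iii) $Y_{\mathbf i}=\Phi(Y_{\mathbf i1}\wedge Y_{\mathbf i2};U_{\mathbf i})$ almost surely for all $\mathbf i$; (iv) for each $d\ge0$ the family $(Y_{\mathbf i})_{|\mathbf i|=d}$ is independent of $\{U_{\mathbf i'}:|\mathbf i'|<d\}$. The tail $\sigma$-algebra is $\mathcal H=\bigcap_{n\ge0}\sigma(\{Y_{\mathbf i}:|\mathbf i|\ge n\})$; the process has trivial tail if every event in $\mathcal H$ has probability $0$ or $1$. *)

(* Defs.v *)
(* MathComp-Analysis development, over an arbitrary R : realType. *)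
From HB Require Import structures.
From mathcomp Require Export all_boot all_order all_algebra.
From mathcomp Require Export all_classical all_reals all_analysis.
From mathcomp Require Export measurable_realfun.
From mathcomp Require Import ring lra.

Set Implicit Arguments.
Unset Strict Implicit.
Unset Printing Implicit Defensive.

Import Order.TTheory GRing.Theory Num.Theory.
Import numFieldNormedType.Exports.

Local Open Scope classical_set_scope.
Local Open Scope ring_scope.
Local Open Scope ereal_scope.

Section independence.
Context {d d' : measure_display} {T : measurableType d} {T' : measurableType d'}
  {R : realType} (P : probability T R).

Definition mutually_independent (J : choiceType) (D : set J)
    (X : J -> {RV P >-> T'}) : Prop :=
  forall (s : seq J) (B : J -> set T'),
    uniq s -> (forall i, i \in s -> D i) ->
    (forall i, i \in s -> measurable (B i)) ->
    P (\bigcap_(i in [set` s]) X i @^-1` B i) =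
      \prod_(i <- s) P (X i @^-1` B i).

Definition sigma_rv (J : choiceType) (D : set J)
    (X : J -> {RV P >-> T'}) : set (set T) :=
  <<s \bigcup_(i in D) g_sigma_algebra_preimage (X i) >>.

Definition independent_sigma (F G : set (set T)) : Prop :=
  forall A B, F A -> G B -> P (A `&` B) = P A * P B.

Definition has_law (X : {RV P >-> T'}) (mu : set T' -> \bar R) : Prop :=
  forall A, measurable A -> distribution P X A = mu A.

End independence.

(* [P] occurs in [{RV P >-> T'}] only as a phantom, hence is kept explicit. *)
Arguments mutually_independent {d d' T T' R} P {J} D X.
Arguments sigma_rv {d d' T T' R} P {J} D X.
Arguments has_law {d d' T T' R} P X mu.

(* Finite words over a two-letter alphabet; [false] and [true] are the letters
   1 and 2, so that the children of [i] are [rcons i false], [rcons i true]. *)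
Definition vertex : choiceType := seq bool.

Section recursive_tree_process.
Context {d : measure_display} {T : measurableType d} {R : realType}
  (P : probability T R).

Definition innovation_process (U : vertex -> {RV P >-> R}) : Prop :=
  mutually_independent P setT U /\
  forall i, has_law P (U i) (uniform_prob (@ltr01 R)).

(* [I]-valued random variables are extended-real-valued ones whose values all
   lie in [I]. That [nu] solves Y =d Phi(min(Y1, Y2); U) is not a separate field:
   it follows from the other conditions at the root when [U] is an innovation
   process. *)
Record invariant_rtp (I : set (\bar R)) (Phi : \bar R -> R -> \bar R)
    (nu : probability (\bar R) R) (U : vertex -> {RV P >-> R})
    (Y : vertex -> {RV P >-> \bar R}) : Prop := InvariantRTP {
  rtp_valued : forall i w, I (Y i w);
  rtp_law : forall i, has_law P (Y i) nu;
  rtp_indep : forall n : nat,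
    mutually_independent P [set i : vertex | size i = n] Y;
  rtp_rec : forall i, {ae P, forall w,
    Y i w = Phi (Order.min (Y (rcons i false) w) (Y (rcons i true) w)) (U i w)};
  rtp_indep_innovation : forall n : nat, independent_sigma P
    (sigma_rv P [set i : vertex | size i = n] Y)
    (sigma_rv P [set i : vertex | (size i < n)%N] U)
}.

Definition tail_sigma (Y : vertex -> {RV P >-> \bar R}) : set (set T) :=
  \bigcap_(n in [set: nat]) sigma_rv P [set i : vertex | (n <= size i)%N] Y.

Definition trivial_tail (Y : vertex -> {RV P >-> \bar R}) : Prop :=
  forall A, tail_sigma Y A -> P A = 0 \/ P A = 1.

End recursive_tree_process.

Arguments innovation_process {d T R} P U.
Arguments invariant_rtp {d T R} P I Phi nu U Y.
Arguments tail_sigma {d T R} P Y.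
Arguments trivial_tail {d T R} P Y.

Section frozen.
Context {R : realType}.

Definition frozen_I : set (\bar R) :=
  [set x | (2^-1)%:E <= x <= 1%:E \/ x = +oo].

Definition frozen_Phi (x : \bar R) (u : R) : \bar R :=
  if u%:E < x then x else +oo.

Definition frozen_nu (A : set (\bar R)) : \bar R :=
  (\int[lebesgue_measure]_(x in `]2^-1%R, 1%R[%classic `&` EFin @^-1` A)
     ((2 * x ^+ 2)^-1)%:E)
  + (2^-1)%:E * \d_(+oo : \bar R) A.

Let mu : measure _ R := @lebesgue_measure R.
Let f (x : R) : R := ((2 * x ^+ 2)^-1)%R.
Let D : set R := `]2^-1%R, 1%R[%classic.

Let f_ge0 x : 0 <= (f x)%:E.
Proof. by rewrite lee_fin invr_ge0 mulr_ge0// sqr_ge0. Qed.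

Let f_cont (x : R) : (2^-1 <= x)%R -> {for x, continuous f}.
Proof.
move=> x2; have x0 : (0 < x)%R by apply: lt_le_trans x2; rewrite invr_gt0.
apply: cvgV; first by rewrite mulf_neq0// ?expf_neq0 ?gt_eqF.
by apply: cvgM; [exact: cvg_cst|exact: exprn_continuous].
Qed.

Let mf : measurable_fun D (EFin \o f).
Proof.
apply: measurableT_comp => //.
apply: open_continuous_measurable_fun; first exact: interval_open.
move=> x; rewrite inE /D/= in_itv/= => /andP[/ltW x2 _].
exact: f_cont.
Qed.

Let dens (A : set (\bar R)) : \bar R :=
  \int[mu]_(x in D `&` EFin @^-1` A) (f x)%:E.

Let mpre (A : set (\bar R)) : measurable A -> measurable (D `&` EFin @^-1` A).
Proof.
move=> mA; apply: measurableI; first exact: measurable_itv.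
have mE : measurable_fun setT (@EFin R).
  by apply/measurable_EFinP; exact: measurable_id.
by rewrite -[_ @^-1` _]setTI; exact: mE.
Qed.

Let frozen_nu0 : frozen_nu set0 = 0.
Proof. by rewrite /frozen_nu preimage_set0 setI0 integral_set0 measure0 mule0 adde0. Qed.

Let frozen_nu_ge0 A : 0 <= frozen_nu A.
Proof.
apply: adde_ge0; first by apply: integral_ge0 => x _; exact: f_ge0.
by rewrite mule_ge0// lee_fin.
Qed.

Let dens_sigma_additive : semi_sigma_additive dens.
Proof.
move=> /= F mF tF mUF; rewrite /dens; apply: cvg_toP.
  apply: ereal_nondecreasing_is_cvgn => m n mn.
  apply: lee_sum_nneg_natr => // k _ _.
  by apply: integral_ge0 => /= x _; exact: f_ge0.
rewrite preimage_bigcup setI_bigcupr ge0_integral_bigcup//=.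
- by move=> i; exact: mpre.
- apply: measurable_funS mf; first exact: measurable_itv.
  by move=> x [i _ []].
- apply/trivIsetP => i j _ _ ij; move/trivIsetP : tF => /(_ i j I I ij).
  move=> Fij; apply/seteqP; split => // x [[_ xi] [_ xj]].
  have : (F i `&` F j) x%:E by split.
  by rewrite Fij.
Qed.

Let frozen_nu_sigma_additive : semi_sigma_additive frozen_nu.
Proof.
move=> /= F mF tF mUF.
have h1 := dens_sigma_additive mF tF mUF.
have h2_ge0 : (0 <= 2^-1 :> R)%R by rewrite invr_ge0.
have h2 := @measure_semi_sigma_additive _ _ _
  (mscale (NngNum h2_ge0) (\d_(+oo : \bar R))) F mF tF mUF.
under eq_cvg do rewrite big_split/=.
apply: cvgeD; [|exact: h1|exact: h2].
apply: ge0_adde_def; rewrite inE.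
  by apply: integral_ge0 => x _; exact: f_ge0.
by rewrite mule_ge0// lee_fin.
Qed.

HB.instance Definition _ := isMeasure.Build _ _ _ frozen_nu
  frozen_nu0 frozen_nu_ge0 frozen_nu_sigma_additive.

Let dF (x : R) : (2^-1 <= x)%R ->
  is_derive x 1%R (fun x => - (2^-1 * x^-1))%R (f x).
Proof.
move=> x2; have x0 : x != 0%R.
  by rewrite gt_eqF//; apply: lt_le_trans x2; rewrite invr_gt0.
have h := @is_deriveV R id x 1%R 1%R x0 (is_derive_id _ _).
have h2 := is_deriveN (is_deriveZ (2^-1)%R h).
apply: is_derive_eq h2 _.
by rewrite /f /GRing.scale/=; field.
Qed.

Let F_cont (x : R) : (2^-1 <= x)%R ->
  {for x, continuous (fun x : R => - (2^-1 * x^-1))%R}.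
Proof.
move=> x2; apply: differentiable_continuous; apply/derivable1_diffP.
by have [] := dF x2.
Qed.

Let frozen_nu_setT : frozen_nu setT = 1.
Proof.
rewrite /frozen_nu preimage_setT setIT diracT mule1.
rewrite integral_itv_bndoo//.
rewrite -(integral_itv_bndoo true false) ?mf//.
rewrite (@continuous_FTC2 _ _ (fun x => - (2^-1 * x^-1))%R)//.
- rewrite -!EFinB -EFinD; congr EFin; rewrite invrK invr1; lra.
- by rewrite invf_lt1// ltr1n.
- apply: continuous_in_subspaceT => x; rewrite inE/= in_itv/= => /andP[x2 _].
  exact: f_cont.
- split.
  + by move=> x; rewrite in_itv/= => /andP[/ltW x2 _]; have [] := dF x2.
  + by apply: cvg_at_right_filter; apply: F_cont.
  + by apply: cvg_at_left_filter; apply: F_cont; rewrite invf_le1// ler1n.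
- move=> x; rewrite in_itv/= => /andP[/ltW x2 _].
  by rewrite derive1E; have [_ ->] := dF x2.
Qed.

HB.instance Definition _ := Measure_isProbability.Build _ _ R
  frozen_nu frozen_nu_setT.

End frozen.

(* Main.v *)
From HB Require Import structures.
Require Import Defs.
From mathcomp Require Import ring lra.

(** Let [Y] be the tree process and, for a threshold [s] in [[1/2, 1]], let
    [Z_m(s)] be the conditional probability that the value at a vertex [i]
    exceeds [s], given the values at depth [m] below [i].  The tail is trivial
    because [Z_m(s)] converges in mean square to the constant
    [nu(]s, +oo]) = 1/(2s)]: far away boundary values do not help predicting
    the value at [i].

    One step of the recursion is explicit.  If [p] is the survival function of
    the minimum of the two children, then integrating out the uniform
    innovation turns it into
    [Psi p (s) = 1/2 + s p(s) - int_{1/2}^s p(x) dx]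
    ([Psi], [Phi_Psi]).  Since [Psi] is affine, it commutes with conditional
    expectations, so [Z_{m+1}] is [Psi] of the product of the two [Z_m] of the
    children ([cond_survival], [cond_survival_expectation]).

    The contraction is in the mean square sense.  Put [F(s) = 1/(2s)] and
    [q = Z_m Z_m' - F^2], where [Z_m] and [Z_m'] belong to two siblings and are
    therefore independent.  If both variances are at most [b] at [s], then
    [E q(s)^2 <= (F + F^2) b], and [s^2 (F + F^2) = s/2 + 1/4 <= 3/4].  As
    [Z_{m+1}(s) - F(s) = s q(s) - int_{1/2}^s q], the local term has a factor
    [3/4], and the remaining term is of Volterra type: measured against the
    steep weight [(2s)^335] it is as small as needed.  This gives
    [Var Z_m(s) <= (15/16)^m (2s)^335] ([Psi_variance],
    [cond_survival_variance]).

    It remains to pass to the tail.  An event [A] that depends only on values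
    [Y_j] computed without the innovations of the first [m] generations below
    [i], for every [m], satisfies [P(A, Y_i > s) = E(1_A Z_m(s))] for all [m],
    hence is independent of [Y_i] ([independent_of_shielded]).  Taking for [A]
    the intersection of a tail event with events on the other vertices of the
    level of [i], and going through this level vertex by vertex, a tail event
    is independent of each level ([tail_independent_level]).  It is also
    independent of the innovations above this level, and these together with
    the level determine all values above it, so it is independent of the whole
    process ([independent_all]), hence of itself. *)

Set Implicit Arguments.
Unset Strict Implicit.
Unset Printing Implicit Defensive.

Import Order.TTheory GRing.Theory Num.Theory.
Import numFieldNormedType.Exports.

Local Open Scope classical_set_scope.
Local Open Scope ring_scope.

(** * Independence and generating families *)
Section independence_theory.
Context {d : measure_display} {T : measurableType d} {R : realType}
  (P : probability T R).
Local Open Scope ereal_scope.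

(** The two finite measures [A |-> P (A `&` E)] and [A |-> P A * P E] agree on
    a pi-system, hence on the sigma-algebra it generates.  One of the two sides
    is kept a single event so that the lemma also applies to the rays that
    generate the Borel sets. *)
Lemma independent_generator (G : set (set T)) (E : set T) :
  setI_closed G -> G `<=` measurable -> measurable E ->
  (forall A, G A -> P (A `&` E) = P A * P E) ->
  forall A, <<s G >> A -> P (A `&` E) = P A * P E.
Proof.
move=> GI Gm mE GE A sGA.
(* uniqueness of measures needs a covering sequence in the pi-system *)
pose G' := G `|` [set setT].
have r0 : (0 <= fine (P E))%R by apply: fine_ge0.
pose m1 : {measure set T -> \bar R} := mrestr P mE.
pose m2 : {measure set T -> \bar R} := mscale (NngNum r0) P.
have m2E B : m2 B = P B * P E.
  by rewrite -[LHS]/((fine (P E))%:E * P B) fineK ?fin_num_measure// muleC.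
have -> : P A * P E = m2 A by rewrite m2E.
rewrite -[LHS]/(m1 A);
  apply: (@g_sigma_algebra_measure_unique _ _ _ G' _ (fun=> setT)).
- by move=> B [/Gm|->//].
- by move=> _; right.
- by rewrite bigcup_const.
- move=> B C [GB|->] [GC|->]; rewrite ?setTI ?setIT;
  [left; exact: GI|left|left|right] => //.
- move=> B [GB|->]; first by rewrite m2E; exact: GE.
  by rewrite m2E probability_setT mul1e -[LHS]/(P (setT `&` E)) setTI.
- move=> _; rewrite -[ltLHS]/(P (setT `&` E)) setTI.
  by rewrite ltey_eq fin_num_measure.
- apply: smallest_sub sGA; first exact: smallest_sigma_algebra.
  by move=> B GB; apply: sub_sigma_algebra; left.
Qed.

Lemma independent_sigmaC (F G : set (set T)) :
  independent_sigma P F G -> independent_sigma P G F.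
Proof. by move=> FG A B GA FB; rewrite setIC FG// muleC. Qed.

Lemma independent_sigma_sub (F F' G G' : set (set T)) :
  F `<=` F' -> G `<=` G' -> independent_sigma P F' G' ->
    independent_sigma P F G.
Proof. by move=> FF GG i A B /FF FA /GG GB; exact: i. Qed.

Lemma gen_measurable (G : set (set T)) : G `<=` measurable ->
  <<s G >> `<=` measurable.
Proof.
by move=> Gm; apply: smallest_sub => //; exact: sigma_algebra_measurable.
Qed.

Lemma independent_sigma_gen (F G : set (set T)) :
  setI_closed F -> F `<=` measurable -> setI_closed G -> G `<=` measurable ->
  independent_sigma P F G -> independent_sigma P <<s F >> <<s G >>.
Proof.
move=> FI Fm GI Gm FG.
have sFG : independent_sigma P <<s F >> G.
  move=> A B sFA GB; apply: (independent_generator FI) => //; first exact: Gm.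
  by move=> C FC; exact: FG.
apply: independent_sigmaC => A B sGA sFB.
apply: (independent_generator GI) => //; first exact: gen_measurable sFB.
by move=> C GC; rewrite setIC sFG// muleC.
Qed.

Section cylinders.
Context {d' : measure_display} {T' : measurableType d'} {J : choiceType}.
Implicit Types (X : J -> {RV P >-> T'}) (D : set J).

(** Finite-dimensional events: unlike the generators in [sigma_rv], they are
    stable under intersection ([cylinder_setI]) and generate the same
    sigma-algebra ([sigma_rvE]). *)
Definition cylinder D X : set (set T) :=
  [set A | exists s : seq J, exists B : J -> set T',
    [/\ forall i, i \in s -> D i, forall i, measurable (B i) &
        A = \bigcap_(i in [set` s]) X i @^-1` B i]].

Lemma measurable_preimage (X : {RV P >-> T'}) (B : set T') :
  measurable B -> measurable (X @^-1` B).
Proof.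
by move=> mB; rewrite -[X in measurable X]setTI; exact: measurable_funP.
Qed.

Lemma cylinder_setI D X : setI_closed (cylinder D X).
Proof.
move=> _ _ [s [B [sD mB ->]]] [s' [B' [s'D mB' ->]]].
exists (s ++ s').
exists (fun i => (if i \in s then B i else setT) `&`
                 (if i \in s' then B' i else setT)); split.
- by move=> i; rewrite mem_cat => /orP[/sD|/s'D].
- by move=> i; apply: measurableI; case: ifP => // _; exact: measurableT.
- apply/seteqP; split=> [x [h h'] i /=|x h].
    by move=> _; split; case: ifP => // ii; [exact: h|exact: h'].
  split=> i /= ii.
    by have [] := h i; rewrite /= ?mem_cat ii.
  by have [] := h i; rewrite /= ?mem_cat ii ?orbT.
Qed.

Lemma cylinder_measurable D X : cylinder D X `<=` measurable.
Proof.
move=> _ [s [B [sD mB ->]]]; apply: fin_bigcap_measurable => // i _.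
exact: measurable_preimage.
Qed.

Lemma sigma_rvE D X : sigma_rv P D X = <<s cylinder D X >>.
Proof.
apply/seteqP; split.
  apply: smallest_sub; first exact: smallest_sigma_algebra.
  move=> A [i Di [B mB <-]].
  apply: sub_sigma_algebra; exists [:: i], (fun=> B).
  split=> //; first by move=> j; rewrite inE => /eqP ->.
  rewrite setTI; apply/seteqP; split=> [x Bx j /=|x /(_ i)/=]; last first.
    by apply; rewrite mem_head.
  by rewrite inE => /eqP ->.
apply: smallest_sub; first exact: smallest_sigma_algebra.
move=> _ [s [B [sD mB ->]]].
pose G := \bigcup_(i in D) g_sigma_algebra_preimage (X i).
rewrite -/G; apply: (@fin_bigcap_measurable _ (g_sigma_algebraType G)) =>
  // i /= si.
apply: sub_sigma_algebra; exists i; first exact: sD.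
by exists (B i) => //; rewrite setTI.
Qed.

Lemma cylinder_prob D X (s : seq J) (B : J -> set T') :
  mutually_independent P D X -> (forall i, i \in s -> D i) ->
  (forall i, measurable (B i)) ->
  P (\bigcap_(i in [set` s]) X i @^-1` B i) =
    \prod_(i <- undup s) P (X i @^-1` B i).
Proof.
move=> XD sD mB.
have -> : [set` s] = [set` undup s].
  by apply/seteqP; split=> i /=; rewrite mem_undup.
by apply: XD => [|i|i _]; [exact: undup_uniq|rewrite mem_undup; exact: sD|].
Qed.

(** On cylinders based on disjoint index sets, the product formula for the
    concatenation of the two lists of indices splits; cylinders generate. *)
Lemma independent_blocks D V W X : mutually_independent P D X ->
  V `<=` D -> W `<=` D -> V `&` W = set0 ->
  independent_sigma P (sigma_rv P V X) (sigma_rv P W X).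
Proof.
move=> XD VD WD VW; rewrite !sigma_rvE; apply: independent_sigma_gen;
  [exact: cylinder_setI|exact: cylinder_measurable|exact: cylinder_setI
  |exact: cylinder_measurable|].
move=> _ _ [s [B [sV mB ->]]] [s' [B' [s'W mB' ->]]].
have ss' i : i \in s' -> i \in s = false.
  move=> is'; apply/negP => is_; have : (V `&` W) i by split;
    [exact: sV|exact: s'W].
  by rewrite VW.
(* a single family of events serving both lists *)
pose C i := if i \in s then B i else B' i.
have -> : \bigcap_(i in [set` s]) X i @^-1` B i =
          \bigcap_(i in [set` s]) X i @^-1` C i.
  by apply: eq_bigcapr => i /=; rewrite /C => ->.
have -> : \bigcap_(i in [set` s']) X i @^-1` B' i =
          \bigcap_(i in [set` s']) X i @^-1` C i.
  by apply: eq_bigcapr => i /= is'; rewrite /C ss'.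
rewrite -bigcap_setU.
have -> : [set` s] `|` [set` s'] = [set` s ++ s'].
  by apply/seteqP; split=> i /=; rewrite mem_cat => /orP.
have mC i : measurable (C i) by rewrite /C; case: ifP.
have sD i : i \in s -> D i by move/sV/VD.
have s'D i : i \in s' -> D i by move/s'W/WD.
rewrite !(cylinder_prob XD)//; last first.
  by move=> i; rewrite mem_cat => /orP[]; [exact: sD|exact: s'D].
rewrite -big_cat/=; apply: perm_big; apply: uniq_perm; first exact: undup_uniq.
  rewrite cat_uniq !undup_uniq andbT/=; apply/hasPn => i.
  by rewrite /= !mem_undup => /ss' ->.
by move=> i; rewrite mem_cat !mem_undup mem_cat.
Qed.

End cylinders.

(** Intersections of an event of [F] with an event of [G] form a pi-system
    generating the join of [F] and [G], so it suffices to look at them. *)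
Lemma independent_joinl (F G H : set (set T)) :
  sigma_algebra setT F -> F `<=` measurable ->
  sigma_algebra setT G -> G `<=` measurable ->
  setI_closed H -> H `<=` measurable ->
  (forall A B C, F A -> G B -> H C ->
    P (A `&` B `&` C) = P (A `&` B) * P C) ->
  independent_sigma P <<s F `|` G >> H.
Proof.
move=> sF Fm sG Gm HI Hm FGH.
pose K := [set A `&` B | A in F & B in G].
have algI (E : set (set T)) : sigma_algebra setT E -> setI_closed E.
  move=> /sigma_algebra_id sE A B; rewrite -sE => EA EB.
  exact: (@measurableI _ (g_sigma_algebraType E)).
have algT (E : set (set T)) : sigma_algebra setT E -> E setT.
  by move=> /sigma_algebra_id <-;
    exact: (@measurableT _ (g_sigma_algebraType E)).
have KI : setI_closed K.
  move=> _ _ [A FA [B GB <-]] [A' FA' [B' GB' <-]].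
  by exists (A `&` A');
    [exact: algI|exists (B `&` B'); [exact: algI|rewrite setIACA]].
have KE : <<s F `|` G >> `<=` <<s K >>.
  apply: smallest_sub; first exact: smallest_sigma_algebra.
  move=> A [FA|GA]; apply: sub_sigma_algebra.
    by exists A => //; exists setT; rewrite ?setIT//; exact: algT.
  by exists setT; [exact: algT|exists A; rewrite ?setTI].
apply: independent_sigma_sub KE (@sub_sigma_algebra _ _ H) _.
apply: independent_sigma_gen => //.
- by move=> _ [A /Fm FA [B /Gm GB <-]]; exact: measurableI.
- by move=> _ C [A FA [B GB <-]] HC; exact: FGH.
Qed.

End independence_theory.
Arguments cylinder_setI {d T R P d' T' J D X}.
Arguments cylinder_measurable {d T R P d' T' J D X} [t] _.

(** * Measurability with respect to a sub-sigma-algebra *)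
Section sub_sigma.
Context {d : measure_display} {T : measurableType d}.

Definition measurable_wrt (F : set (set T)) {d'} {T' : measurableType d'}
    (f : T -> T') : Prop :=
  @measurable_fun _ _ (g_sigma_algebraType F) T' setT f.

Lemma measurable_wrtP (F : set (set T)) d' (T' : measurableType d') (f : T ->
  T') :
  sigma_algebra setT F ->
  measurable_wrt F f <-> forall B, measurable B -> F (f @^-1` B).
Proof.
move=> /sigma_algebra_id sF; split=> [mf B mB|mf mT B mB].
  by rewrite -sF -[X in _ X]setTI; exact: mf.
by rewrite setTI /measurable/= sF; exact: mf.
Qed.

Lemma measurable_wrt_sub (F G : set (set T)) d' (T' : measurableType d') (f :
  T -> T') :
  F `<=` <<s G >> -> measurable_wrt F f -> measurable_wrt G f.
Proof.
move=> FG mf mT B mB.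
have : <<s F >> (setT `&` f @^-1` B) by exact: mf.
by apply: smallest_sub => //; exact: smallest_sigma_algebra.
Qed.

Lemma measurable_wrt_measurable (F : set (set T)) d' (T' : measurableType d')
    (f : T -> T') :
  F `<=` measurable -> measurable_wrt F f -> measurable_fun setT f.
Proof.
move=> Fm mf mT B mB; apply: (gen_measurable Fm); exact: mf.
Qed.

End sub_sigma.

Section ae_probability.
Context {d : measure_display} {T : measurableType d} {R : realType}
  (P : probability T R).
Local Open Scope ereal_scope.

Lemma ae_le_measure (A B : set T) : measurable A -> measurable B ->
  {ae P, forall w, A w -> B w} -> P A <= P B.
Proof.
move=> mA mB [N [mN N0 sub]].
have -> : P B = P (B `|` N) by rewrite measureU0.
apply: le_measure; rewrite ?inE//; first exact: measurableU.
move=> w Aw; have [|nBw] := pselect (B w); [by left|right].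
by apply: sub => /= /(_ Aw).
Qed.

Lemma ae_eq_measure (A B : set T) : measurable A -> measurable B ->
  {ae P, forall w, A w <-> B w} -> P A = P B.
Proof.
move=> mA mB AB; apply/eqP; rewrite eq_le; apply/andP; split;
  by apply: ae_le_measure => //; apply: filterS AB => w [].
Qed.

Lemma ae_seq (I : eqType) (s : seq I) (Q : I -> T -> Prop) :
  (forall i, i \in s -> {ae P, forall w, Q i w}) ->
  {ae P, forall w i, i \in s -> Q i w}.
Proof.
elim: s => [|i s ih] h; first by apply: aeW.
have h1 := h i (mem_head _ _).
have h2 : {ae P, forall w i, i \in s -> Q i w}.
  by apply: ih => j js; apply: h; rewrite inE js orbT.
apply: filterS2 h1 h2 => w h1 h2 j; rewrite inE => /orP[/eqP ->//|]; exact: h2.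
Qed.

End ae_probability.

Section sigma_rv_theory.
Context {d d' : measure_display} {T : measurableType d} {T' : measurableType d'}
  {R : realType} (P : probability T R) {J : choiceType}.
Implicit Types (X : J -> {RV P >-> T'}) (D : set J).

Lemma sigma_rv_algebra D X : sigma_algebra setT (sigma_rv P D X).
Proof. exact: smallest_sigma_algebra. Qed.

Lemma sigma_rv_measurable D X : sigma_rv P D X `<=` measurable.
Proof.
rewrite sigma_rvE; apply: gen_measurable; exact: cylinder_measurable.
Qed.

Lemma sigma_rv_preimage D X i B : D i -> measurable B ->
  sigma_rv P D X (X i @^-1` B).
Proof.
by move=> Di mB; apply: sub_sigma_algebra; exists i => //; exists B => //;
  rewrite setTI.
Qed.

Lemma sigma_rv_sub D D' X : D `<=` D' -> sigma_rv P D X `<=` sigma_rv P D' X.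
Proof.
move=> DD; apply: smallest_sub; first exact: sigma_rv_algebra.
by move=> A [i /DD Di iA]; apply: sub_sigma_algebra; exists i.
Qed.

Lemma measurable_wrt_rv D X i : D i -> measurable_wrt (sigma_rv P D X) (X i).
Proof.
move=> Di; apply/measurable_wrtP; first exact: sigma_rv_algebra.
by move=> B; exact: sigma_rv_preimage.
Qed.

Lemma sigma_rv_setI D X A B : sigma_rv P D X A -> sigma_rv P D X B ->
  sigma_rv P D X (A `&` B).
Proof.
move=> DA DB; exact: (@measurableI _ (g_sigma_algebraType
  (\bigcup_(i in D) g_sigma_algebra_preimage (X i)))).
Qed.

End sigma_rv_theory.
Arguments sigma_rv_algebra {d d' T T' R P J D X}.
Arguments sigma_rv_measurable {d d' T T' R P J D X} [t] _.

(** * Unfolding the recursion down to a level *)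

Section unfolding.
Context {d : measure_display} {T : measurableType d} {R : realType}
  (P : probability T R).
Context (I : set (\bar R)) (Phi : \bar R -> R -> \bar R)
  (nu : probability (\bar R) R)
  (U : vertex -> {RV P >-> R}) (Y : vertex -> {RV P >-> \bar R}).
Context (mPhi : measurable_fun setT (fun xu => Phi xu.1 xu.2))
  (hU : innovation_process P U) (hY : invariant_rtp P I Phi nu U Y).
Local Open Scope ereal_scope.

(** The value at [i] recomputed from the values [k] generations below and the
    innovations in between: an everywhere defined version of [Y i] that is
    exactly measurable with respect to these data, whereas [Y i] is so only up
    to a null set. *)
Fixpoint unfold_rtp (k : nat) (i : vertex) (w : T) : \bar R :=
  if k is k'.+1 then
    Phi (Order.min (unfold_rtp k' (rcons i false) w)
                   (unfold_rtp k' (rcons i true) w)) (U i w)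
  else Y i w.

Lemma unfold_rtp_ae k i : {ae P, forall w, Y i w = unfold_rtp k i w}.
Proof.
elim: k i => [|k ih] i /=; first exact: aeW.
apply: filterS3 (ih (rcons i false)) (ih (rcons i true)) (rtp_rec hY i).
by move=> w <- <-.
Qed.

Lemma measurable_wrt_unfold (F : set (set T)) k i :
  (forall v : vertex, size v = k -> measurable_wrt F (Y (i ++ v))) ->
  (forall v : vertex, (size v < k)%N -> measurable_wrt F (U (i ++ v))) ->
  measurable_wrt F (unfold_rtp k i).
Proof.
elim: k i => [|k ih] i mY mU /=.
  by have := mY [::] erefl; rewrite cats0.
have mc b : measurable_wrt F (unfold_rtp k (rcons i b)).
  by apply: ih => v vk; rewrite cat_rcons; [apply: mY|apply: mU] => //=;
    rewrite vk.
apply: (@measurableT_comp _ _ _ (g_sigma_algebraType F) _ _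
  (fun xu => Phi xu.1 xu.2) setT (fun w =>
    (Order.min (unfold_rtp k (rcons i false) w)
                   (unfold_rtp k (rcons i true) w), U i w)) mPhi).
apply: measurable_fun_pair.
  by apply: (@measurable_mine _ (g_sigma_algebraType F) R setT _ _ (mc false)
    (mc true)).
by have := mU [::] isT; rewrite cats0.
Qed.

(** All vertices of a finite-dimensional event lie above some level [M]; replace
    each value by its unfolding down to that level.  Only innovations of
    descendants of [D] occur, which is what independence arguments need. *)
Lemma cylinder_unfold (D : set vertex) (A : set T) : cylinder D Y A ->
  exists M0 : nat, forall M, (M0 <= M)%N ->
  exists A', <<s sigma_rv P [set i : vertex | size i = M] Y `|`
      sigma_rv P [set i : vertex | (size i < M)%N /\
                    exists j v, D j /\ i = j ++ v :> vertex] U >> A' /\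
    {ae P, forall w, A w <-> A' w}.
Proof.
move=> [s [B [sD mB ->]]]; exists (\max_(i <- s) size i)%N => M leM.
have sM i : i \in s -> (size i <= M)%N.
  by move=> si; apply: leq_trans leM; exact: leq_bigmax_seq.
set F := _ `|` _.
exists (\bigcap_(i in [set` s]) unfold_rtp (M - size i) i @^-1` B i); split.
  apply: (@fin_bigcap_measurable _ (g_sigma_algebraType F)) => // i /= si.
  rewrite -[X in measurable X]setTI; apply: measurable_wrt_unfold (mB i) =>
    // v vM.
    apply: (@measurable_wrt_sub _ _
      (sigma_rv P [set i : vertex | size i = M] Y)).
      by move=> C FC; apply: sub_sigma_algebra; left.
    by apply: measurable_wrt_rv; rewrite /= size_cat vM subnKC// sM.
  apply: (@measurable_wrt_sub _ _
    (sigma_rv P [set i : vertex | (size i < M)%N /\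
                    exists j v, D j /\ i = j ++ v :> vertex] U)).
    by move=> C FC; apply: sub_sigma_algebra; right.
  apply: measurable_wrt_rv => /=; split.
    by rewrite size_cat -ltn_subRL.
  by exists i, v; split => //; exact: sD.
have : {ae P, forall w i, i \in s -> Y i w = unfold_rtp (M - size i) i w}.
  by apply: ae_seq => i _; exact: unfold_rtp_ae.
apply: filterS => w h; split=> h' i /= si; have := h' i si; rewrite /= h//.
Qed.

Lemma levels_innovations_measurable M V :
  <<s sigma_rv P [set i : vertex | size i = M] Y `|` sigma_rv P V U
    >> `<=` measurable.
Proof. by apply: gen_measurable => A [|]; exact: sigma_rv_measurable. Qed.

(** The values on [D] are computed from a deep level and from the innovations of
    the descendants of [D].  The deep level is independent of all innovations
    above it, and the innovations on [W] are independent of the others. *)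
Lemma independent_innovations (D W : set vertex) :
  (forall j v : vertex, D j -> ~ W (j ++ v)) ->
  independent_sigma P (sigma_rv P D Y) (sigma_rv P W U).
Proof.
move=> DW; rewrite !sigma_rvE; apply: independent_sigma_gen;
  [exact: cylinder_setI|exact: cylinder_measurable|exact: cylinder_setI
  |exact: cylinder_measurable|].
move=> A C DA WC.
have [M0 hM0] := cylinder_unfold DA.
case: WC (cylinder_measurable WC) => s [B [sW mB CE]] mC.
(* deep enough for the values of [A] and the innovations of [C] *)
pose M := maxn M0 (\max_(i <- s) size i).+1.
have [A' [mA' AA']] := hM0 M (leq_maxl _ _).
pose V := [set i : vertex | (size i < M)%N /\ exists j v, D j /\ i =
  j ++ v :> vertex].
pose W' := [set i : vertex | (size i < M)%N /\ W i].
have W'C : sigma_rv P W' U C.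
  rewrite sigma_rvE; apply: sub_sigma_algebra; exists s, B; split => // i si;
    split.
    by rewrite /= leq_max; apply/orP; right; rewrite ltnS;
      exact: leq_bigmax_seq.
  exact: sW.
have VW' : V `&` W' = set0.
  by apply/seteqP; split=> // i [[_ [j [v [Dj ->]]]] [_ /=]]; exact: DW.
have mA'' := levels_innovations_measurable mA'.
have mA := cylinder_measurable DA.
have -> : P A = P A' by exact: ae_eq_measure.
have -> : P (A `&` C) = P (A' `&` C).
  apply: ae_eq_measure; [exact: measurableI|exact: measurableI|].
  by apply: filterS AA' => w AA'; split=> -[/AA'].
apply: (independent_joinl _ _ _ _ _ _ _ mA' W'C);
  [exact: sigma_rv_algebra|exact: sigma_rv_measurable|exact: sigma_rv_algebra
  |exact: sigma_rv_measurable| |exact: sigma_rv_measurable|].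
  by move=> ? ?; exact: sigma_rv_setI.
move=> E1 E2 E3 h1 h2 h3.
pose L := [set i : vertex | (size i < M)%N].
have h2' : sigma_rv P L U E2 by apply: sigma_rv_sub h2 => i [].
have h3' : sigma_rv P L U E3 by apply: sigma_rv_sub h3 => i [].
have Yn := rtp_indep_innovation hY.
rewrite -setIA (Yn M _ _ h1 (sigma_rv_setI h2' h3')) (Yn M _ _ h1 h2') -muleA.
congr (_ * _).
by apply: (independent_blocks hU.1 _ _ VW').
Qed.

(** The values above level [n] are functions of level [n] and of the
    innovations above it.  A tail event together with level [n] is independent
    of these innovations, so independence of level [n] alone is enough. *)
Lemma independent_all (A : set T) :
  (forall n, sigma_rv P [set i : vertex | (n <= size i)%N] Y A) ->
  (forall n, independent_sigma P (sigma_rv P [set i : vertex | size i = n] Y)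
    [set A]) ->
  independent_sigma P (sigma_rv P setT Y) [set A].
Proof.
move=> tA iA.
have mA : measurable A by exact: sigma_rv_measurable (tA 0%N).
have AI : setI_closed [set A] by move=> ? ? /= -> ->; rewrite setIid.
have Am : [set A] `<=` measurable by move=> ? ->.
rewrite sigma_rvE => E _ cE ->; move: E cE.
apply: independent_generator => //;
  [exact: cylinder_setI|exact: cylinder_measurable|].
move=> E cE; have [M /(_ M (leqnn _))[E' [sE' EE']]] := cylinder_unfold cE.
have mE' := levels_innovations_measurable sE'.
have mE := cylinder_measurable cE.
have -> : P E = P E' by exact: ae_eq_measure.
have -> : P (E `&` A) = P (E' `&` A).
  apply: ae_eq_measure; [exact: measurableI|exact: measurableI|].
  by apply: filterS EE' => w EE'; split=> -[/EE'].
apply: (independent_joinl _ _ _ _ AI Am _ sE') => //;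
  [exact: sigma_rv_algebra|exact: sigma_rv_measurable|exact: sigma_rv_algebra
  |exact: sigma_rv_measurable|].
move=> E1 E2 _ h1 h2 ->.
have h1' : sigma_rv P [set i : vertex | (M <= size i)%N] Y E1.
  by apply: sigma_rv_sub h1 => i /= ->.
have h2' : sigma_rv P [set i : vertex | (size i < M)%N] U E2.
  by apply: sigma_rv_sub h2 => i [].
have ind : independent_sigma P (sigma_rv P [set i : vertex | (M <= size i)%N] Y)
    (sigma_rv P [set i : vertex | (size i < M)%N] U).
  apply: independent_innovations => j v /= Mj.
  by rewrite size_cat ltnNge (leq_trans Mj (leq_addr _ _)).
rewrite setIAC (ind _ _ (sigma_rv_setI h1' (tA M)) h2') (ind _ _ h1' h2').
by rewrite (iA M _ _ h1 erefl) muleAC.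
Qed.

End unfolding.

(** * Integrals of bounded measurable functions *)
Section bounded_measurable.
Context {R : realType}.

(** All integrands are bounded and all measures are probabilities; this class is
    closed under the ring operations and partial integration, and is always
    integrable, which removes integrability side conditions. *)
Definition bounded_measurable {d} {T : measurableType d} (f : T -> R) : Prop :=
  measurable_fun setT f /\ exists M : R, forall x, `|f x| <= M.

Section closure.
Context {d : measure_display} {T : measurableType d}.
Implicit Types f g : T -> R.

Lemma bm_cst r : bounded_measurable (fun _ : T => r).
Proof. by split; [exact: measurable_cst|exists `|r|]. Qed.

Lemma bm_add f g : bounded_measurable f -> bounded_measurable g ->
  bounded_measurable (fun x => f x + g x).
Proof.
move=> [mf [M fM]] [mg [N gN]]; split; first exact: measurable_funD.
by exists (M + N) => x; apply: le_trans (ler_normD _ _) _; exact: lerD.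
Qed.

Lemma bm_opp f : bounded_measurable f -> bounded_measurable (fun x => - f x).
Proof.
move=> [mf [M fM]]; split; first exact: measurable_funN.
by exists M => x; rewrite normrN.
Qed.

Lemma bm_sub f g : bounded_measurable f -> bounded_measurable g ->
  bounded_measurable (fun x => f x - g x).
Proof. by move=> bf bg; apply: bm_add => //; exact: bm_opp. Qed.

Lemma bm_mul f g : bounded_measurable f -> bounded_measurable g ->
  bounded_measurable (fun x => f x * g x).
Proof.
move=> [mf [M fM]] [mg [N gN]]; split; first exact: measurable_funM.
by exists (M * N) => x; rewrite normrM; apply: ler_pM.
Qed.

Lemma bm_sqr f : bounded_measurable f -> bounded_measurable (fun x => f x ^+ 2).
Proof. by move=> bf; apply: bm_mul. Qed.

Lemma bm_comp {d'} {T' : measurableType d'} (h : T' -> T) f :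
  measurable_fun setT h -> bounded_measurable f ->
  bounded_measurable (fun x => f (h x)).
Proof.
move=> mh [mf [M fM]]; split; last by exists M => x.
exact: (measurableT_comp mf mh).
Qed.

Lemma bm_bool (b : T -> bool) : measurable_fun setT b ->
  bounded_measurable (fun x => (b x)%:R).
Proof.
move=> mb; split; last by exists 1 => x; case: (b x); rewrite ?normr1 ?normr0.
have := measurable_fun_ifT mb (measurable_cst (1 : R)) (measurable_cst (0 : R)).
by apply: eq_measurable_fun => x _; case: (b x).
Qed.

Context (mu : probability T R).

Lemma bm_integrable f : bounded_measurable f -> mu.-integrable setT (EFin \o f).
Proof.
move=> [mf [M fM]]; apply: measurable_bounded_integrable => //.
  by rewrite ltey_eq fin_num_measure.
exists M; split; first exact: num_real.
by move=> x Mx t _; apply: le_trans (fM t) (ltW Mx).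
Qed.

Lemma Rint_add f g : bounded_measurable f -> bounded_measurable g ->
  \int[mu]_x (f x + g x) = \int[mu]_x f x + \int[mu]_x g x.
Proof. by move=> bf bg; rewrite RintegralD//; exact: bm_integrable. Qed.

Lemma Rint_sub f g : bounded_measurable f -> bounded_measurable g ->
  \int[mu]_x (f x - g x) = \int[mu]_x f x - \int[mu]_x g x.
Proof. by move=> bf bg; rewrite RintegralB//; exact: bm_integrable. Qed.

Lemma Rint_mulr f r : bounded_measurable f ->
  \int[mu]_x (r * f x) = r * \int[mu]_x f x.
Proof. by move=> bf; rewrite RintegralZl//; exact: bm_integrable. Qed.

Lemma Rint_cst r : \int[mu]_x r = r.
Proof.
by rewrite Rintegral_cst// (congr1 fine (probability_setT mu)) mulr1.
Qed.

Lemma Rint_le f g : bounded_measurable f -> bounded_measurable g ->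
  (forall x, f x <= g x) -> \int[mu]_x f x <= \int[mu]_x g x.
Proof. by move=> bf bg fg; apply: le_Rintegral => //; exact: bm_integrable. Qed.

Lemma Rint_indic A : measurable A -> \int[mu]_x \1_A x = fine (mu A).
Proof. by move=> mA; rewrite /Rintegral integral_indic// setIT. Qed.

Lemma bm_indic A : measurable A -> bounded_measurable (\1_A : T -> R).
Proof.
move=> mA; split; first exact: measurable_indic.
by exists 1 => x; rewrite indicE; case: (_ \in _); rewrite ?normr1 ?normr0.
Qed.

(** Jensen's inequality for the square: the variance is nonnegative. *)
Lemma Rint_sqr f : bounded_measurable f ->
  (\int[mu]_x f x) ^+ 2 <= \int[mu]_x (f x ^+ 2).
Proof.
move=> bf; set m := \int[mu]_x f x.
have : 0 <= \int[mu]_x ((f x - m) ^+ 2).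
  by apply: Rintegral_ge0 => x _; exact: sqr_ge0.
have bm : bounded_measurable (fun x => (2 * m) * f x).
  by apply: bm_mul => //; exact: bm_cst.
have -> : \int[mu]_x ((f x - m) ^+ 2) =
          \int[mu]_x ((f x ^+ 2 - (2 * m) * f x) + m ^+ 2).
  by apply: eq_Rintegral => x _; ring.
rewrite Rint_add; [|by apply: bm_sub => //; exact: bm_sqr|exact: bm_cst].
rewrite Rint_sub//; last exact: bm_sqr.
rewrite Rint_mulr// Rint_cst -/m; lra.
Qed.

Lemma Rint_ae_eq f g : bounded_measurable f -> bounded_measurable g ->
  {ae mu, forall x, f x = g x} -> \int[mu]_x f x = \int[mu]_x g x.
Proof.
move=> [mf _] [mg _] fg; rewrite /Rintegral; congr fine.
apply: ae_eq_integral => //; [exact/measurable_EFinP|exact/measurable_EFinP|].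
by apply: filterS fg => x -> .
Qed.

End closure.

Section fubini.
Context {d1 d2 : measure_display}
  {T1 : measurableType d1} {T2 : measurableType d2}.
Context (m1 : probability T1 R) (m2 : probability T2 R).
Implicit Types f : T1 * T2 -> R.

Lemma bm_slice1 f y : bounded_measurable f ->
  bounded_measurable (fun x => f (x, y)).
Proof.
by apply: (@bm_comp _ _ _ _ (fun x => (x, y))); exact: pair2_measurable.
Qed.

Lemma bm_slice2 f x : bounded_measurable f ->
  bounded_measurable (fun y => f (x, y)).
Proof.
by apply: (@bm_comp _ _ _ _ (fun y => (x, y))); exact: pair1_measurable.
Qed.

Lemma bm_Rint f : bounded_measurable f ->
  bounded_measurable (fun x => \int[m2]_y f (x, y)).
Proof.
move=> bf; have [mf [M fM]] := bf; split; last first.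
  exists M => x; have bfx := bm_slice2 x bf.
  apply: le_trans (le_normr_Rintegral _ (bm_integrable m2 bfx)) _ => //.
  rewrite -[leRHS](Rint_cst m2); apply: Rint_le => //; last exact: bm_cst.
  by split; [apply: measurableT_comp => //; exact: bfx.1|
    exists M => y; rewrite normr_id].
(* Tonelli needs a nonnegative integrand: shift by the bound *)
have bg : bounded_measurable (fun z => f z + M) by apply: bm_add => //;
  exact: bm_cst.
have -> : (fun x => \int[m2]_y f (x, y)) =
    (fun x => fine (\int[m2]_y (f (x, y) + M)%:E)%E - M).
  apply/funext => x; rewrite -[fine _]/(\int[m2]_y (f (x, y) + M)).
  rewrite Rint_add ?Rint_cst ?addrK//; [exact: bm_slice2|exact: bm_cst].
apply: measurable_funB => //; apply: measurableT_comp => //.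
apply: (measurable_fun_fubini_tonelli_F (fun z => (f z + M)%:E)).
  by apply/measurable_EFinP; exact: bg.1.
by move=> z; rewrite lee_fin; have := fM z; rewrite ler_norml => /andP[]; lra.
Qed.

Lemma bm_prod_integrable f : bounded_measurable f ->
  (m1 \x m2)%E.-integrable setT (EFin \o f).
Proof.
move=> bf; have [mf [M fM]] := bf.
have icst d (T : measurableType d) (m : probability T R) :
  (\int[m]_x (M%:E) = M%:E)%E.
  by rewrite integral_cst// (congr1 (mule M%:E) (probability_setT m)) mule1.
apply/integrable12ltyP; first exact/measurable_EFinP.
apply: (@le_lt_trans _ _ (\int[m1]_x (M%:E))%E); last by rewrite icst ltry.
apply: ge0_le_integral => //.
- by move=> x _; apply: integral_ge0.
- apply: (measurable_fun_fubini_tonelli_F (fun z => `|(f z)%:E|%E)) => //.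
  by apply: measurableT_comp => //; exact/measurable_EFinP.
- move=> x _; rewrite -(icst _ _ m2); apply: ge0_le_integral => //.
  + apply: measurableT_comp => //; apply/measurable_EFinP.
    exact: (bm_slice2 x bf).1.
  + by move=> y _; rewrite -[leLHS]/(`|f (x, y)|%:E) lee_fin.
Qed.

Lemma Rint_prod f : bounded_measurable f ->
  \int[(m1 \x m2)%E]_z f z = \int[m1]_x \int[m2]_y f (x, y).
Proof.
move=> bf; rewrite /Rintegral -integral12_prod_meas1;
  last exact: bm_prod_integrable.
congr fine; apply: eq_integral => x _; rewrite fineK//.
by apply: integrable_fin_num => //; apply: bm_integrable; exact: bm_slice2.
Qed.

Lemma Rint_fubini f : bounded_measurable f ->
  \int[m1]_x \int[m2]_y f (x, y) = \int[m2]_y \int[m1]_x f (x, y).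
Proof.
move=> bf; rewrite -Rint_prod// /Rintegral -integral21_prod_meas1; last first.
  exact: bm_prod_integrable.
congr fine; apply: eq_integral => y _; rewrite fineK//.
by apply: integrable_fin_num => //; apply: bm_integrable; exact: bm_slice1.
Qed.

End fubini.
End bounded_measurable.

Section independent_fubini.
Context {d : measure_display} {T : measurableType d} {R : realType}
  (P : probability T R).

(** If [F] and [G] are independent, the law of [w |-> (w, w)] on the product of
    the two measurable spaces [(T, F)] and [(T, G)] is the product of the
    restrictions of [P].  Hence a random element of [F] and one of [G] may be
    integrated out one after the other. *)
Lemma independent_fubini (F G : set (set T)) (f : T * T -> R) :
  sigma_algebra setT F -> F `<=` measurable ->
  sigma_algebra setT G -> G `<=` measurable ->
  independent_sigma P F G ->
  @bounded_measurable R _ (g_sigma_algebraType F * g_sigma_algebraType G)%type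
    f ->
  \int[P]_w f (w, w) = \int[P]_w \int[P]_w' f (w, w').
Proof.
move=> sF Fm sG Gm FG bf.
have FE := sigma_algebra_id sF; have GE := sigma_algebra_id sG.
pose TF : measurableType _ := g_sigma_algebraType F.
pose TG : measurableType _ := g_sigma_algebraType G.
have mF : @measurable_fun _ _ T TF setT id.
  by move=> _ B; rewrite /measurable/= FE setTI => /Fm.
have mG : @measurable_fun _ _ T TG setT id.
  by move=> _ B; rewrite /measurable/= GE setTI => /Gm.
have mFG : @measurable_fun _ _ T (TF * TG)%type setT (fun w => (w, w)).
  exact: (measurable_fun_pair mF mG).
pose iF : {mfun T >-> TF} :=
  HB.pack (id : T -> TF) (isMeasurableFun.Build _ _ _ _ _ mF).
pose iG : {mfun T >-> TG} :=
  HB.pack (id : T -> TG) (isMeasurableFun.Build _ _ _ _ _ mG).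
pose iFG : {mfun T >-> (TF * TG)%type} :=
  HB.pack ((fun w => (w, w)) : T -> (TF * TG)%type)
    (isMeasurableFun.Build _ _ _ _ _ mFG).
pose PF := distribution P iF; pose PG := distribution P iG.
have E X : measurable X -> (PF \x PG)%E X = distribution P iFG X.
  apply: product_measure_unique => A B mA mB.
  have FA : F A by move: mA; rewrite /measurable/= FE.
  have GB : G B by move: mB; rewrite /measurable/= GE.
  exact: FG.
have bP := @bm_Rint R _ _ TF TG PG f bf.
have RintE d' (T' : measurableType d') (h : {mfun T >-> T'}) (g : T' -> R) :
    bounded_measurable g -> \int[P]_w g (h w) = \int[distribution P h]_x g x.
  move=> bg; rewrite /Rintegral integral_distribution//.
    by apply/measurable_EFinP; exact: bg.1.
  exact/bm_integrable/(bm_comp (measurable_funP h) bg).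
transitivity (\int[distribution P iFG]_x f x); first exact: (RintE _ _ iFG).
transitivity (\int[PF]_x \int[PG]_y f (x, y)); last first.
  rewrite -(RintE _ _ iF _ bP); apply: eq_Rintegral => w _.
  by rewrite -(RintE _ _ iG (fun y => f (iF w, y)))//; exact: bm_slice2.
rewrite -(@Rint_prod R _ _ TF TG)// /Rintegral.
by rewrite (eq_measure_integral (PF \x PG)%E)// => A mA _; exact/esym/E.
Qed.
End independent_fubini.

(** * Integrals against the uniform law *)
Section uniform.
Context {R : realType}.
Notation unif := (uniform_prob (@ltr01 R)).
Notation mu := (@lebesgue_measure R).

Lemma Rint_unif (f : R -> R) : bounded_measurable f -> (forall x, 0 <= f x) ->
  \int[unif]_x f x = \int[mu]_(x in `[0, 1]) f x.
Proof.
move=> [mf _] f0; rewrite /Rintegral integral_uniform//.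
  by rewrite subr0 invr1 mul1e.
exact/measurable_EFinP.
Qed.

Lemma measurable_itv_co (a b : R) :
  measurable_fun setT (fun x : R => x \in `[a, b[).
Proof.
have -> : (fun x : R => x \in `[a, b[) = (fun x : R => (a <= x) && (x < b)).
  by apply/funext => x; rewrite in_itv.
apply: measurable_and; first exact: measurable_fun_ler.
exact: measurable_fun_ltr.
Qed.

Lemma bm_itv_co (a b : R) :
  bounded_measurable (fun x : R => (x \in `[a, b[)%:R : R).
Proof. by apply: bm_bool; exact: measurable_itv_co. Qed.

Lemma unif_itv_co (a b : R) : 0 <= a -> a <= b -> b <= 1 ->
  \int[unif]_x (x \in `[a, b[)%:R = b - a.
Proof.
move=> a0 ab b1; rewrite Rint_unif;
  [|exact: bm_itv_co|by move=> x; rewrite ler0n].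
have -> : \int[mu]_(x in `[0, 1]) (x \in `[a, b[)%:R =
    \int[mu]_(x in `[0, 1]) \1_(`[a, b[) x.
  by apply: eq_Rintegral => x _; rewrite indicE mem_setE.
rewrite /Rintegral integral_indic//.
have -> : `[a, b[ `&` `[0, 1] = `[a, b[%classic.
  apply/setIidPl => x /=; rewrite !in_itv/= => /andP[ax xb].
  by rewrite (le_trans a0 ax) (ltW (lt_le_trans xb b1)).
rewrite (congr1 fine (lebesgue_measure_itv `[a, b[))/= lte_fin;
  case: ltP => //= ba.
by apply/esym/eqP; rewrite subr_eq0 eq_le ab ba.
Qed.

Lemma unif_lt (x : R) : 0 <= x <= 1 -> \int[unif]_u (u < x)%R%:R = x.
Proof.
move=> /andP[x0 x1]; rewrite Rint_unif; last 2 first.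
- by apply: bm_bool; exact: measurable_fun_ltr.
- by move=> u; rewrite ler0n.
rewrite -[RHS]subr0 -(unif_itv_co (lexx 0) x0 x1) Rint_unif; last 2 first.
- exact: bm_itv_co.
- by move=> u; rewrite ler0n.
by apply: eq_Rintegral => u; rewrite inE/= !in_itv/= => /andP[->].
Qed.

Lemma itv_pow_bm (k : nat) (s : R) :
  bounded_measurable (fun x : R => (x \in `[2^-1, s[)%:R * (2 * x) ^+ k).
Proof.
split.
  apply: measurable_funM; first exact: (bm_itv_co _ _).1.
  by apply: measurable_funX; exact: measurable_funM.
have bnd (x : R) : `|(x \in `[2^-1, s[)%:R * (2 * x) ^+ k| <= `|2 * s| ^+ k.
  rewrite normrM normrX.
  case: (boolP (x \in _)); last by rewrite normr0 mul0r exprn_ge0.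
  rewrite in_itv/= normr1 mul1r.
  move=> /andP[x2 xs]; apply: lerXn2r; rewrite ?nnegrE//.
  have x0 : 0 <= 2 * x by lra.
  have s0 : 0 <= 2 * s by lra.
  by rewrite (ger0_norm x0) (ger0_norm s0); lra.
by exists (`|2 * s| ^+ k).
Qed.

(** The weight [(2 x) ^+ k] is steep: its integral up to [s] is a small multiple
    of its value at [s].  This is what absorbs the Volterra term below. *)
Lemma itv_pow_integral (k : nat) (s : R) : 2^-1 <= s <= 1 ->
  \int[unif]_x ((x \in `[2^-1, s[)%:R * (2 * x) ^+ k) <= (2 * s) ^+ k / k.+1%:R.
Proof.
move=> /andP[s2 s1].
have k0 : (0 : R) < k.+1%:R by rewrite ltr0n.
have F0 : 0 <= (2 * s) ^+ k / k.+1%:R by rewrite divr_ge0// ?exprn_ge0 ?ler0n//;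
  lra.
have [s2'|s2'] := eqVneq s 2^-1.
  rewrite (@eq_Rintegral _ _ _ _ _ (fun=> 0)); first by rewrite Rint_cst.
  move=> x _; rewrite in_itv/= s2'; case: andP => [[]|]; last by rewrite mul0r.
  by move=> a b; have := le_lt_trans a b; rewrite ltxx.
have {}s2 : 2^-1 < s by rewrite lt_neqAle eq_sym s2'.
rewrite Rint_unif; [|exact: itv_pow_bm|]; last first.
  move=> x; rewrite in_itv/=; case: andP => [[x2 _]|]; last by rewrite mul0r.
  by rewrite mul1r exprn_ge0//; lra.
have -> : \int[mu]_(x in `[0, 1]) ((x \in `[2^-1, s[)%:R * (2 * x) ^+ k) =
    \int[mu]_(x in `[2^-1, s[) ((2 * x) ^+ k).
  rewrite Rintegral_mkcond [RHS]Rintegral_mkcond; apply: eq_Rintegral => x _.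
  rewrite !patchE !mem_setE; case: (boolP (x \in `[2^-1, s[)); last first.
    by rewrite mul0r; case: ifP.
  rewrite !in_itv/= => /andP[x2 xs]; rewrite mul1r ifT//; apply/andP; split;
    lra.
pose F (x : R) := (2 * k.+1%:R)^-1 * (2 * x) ^+ k.+1.
have dF (x : R) : is_derive x 1 F ((2 * x) ^+ k).
  have h : is_derive x 1 (fun y : R => 2 * y) 2.
    by have := @is_deriveZ _ _ _ (@id R) 2 x 1 1 (is_derive_id _ _);
      rewrite /GRing.scale/= mulr1.
  have := is_deriveZ (2 * k.+1%:R)^-1 (@is_deriveX _ _ _ k.+1 x 1 2 h).
  rewrite exprfctE => h2; apply: is_derive_eq h2 _.
  by rewrite /GRing.scale/=; field.
have cf (x : R) : {for x, continuous (fun x : R => (2 * x) ^+ k)}.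
  apply: (@continuous_comp _ _ _ (fun y : R => 2 * y) (fun y : R => y ^+ k)).
    by apply: cvgM; [exact: cvg_cst|exact: cvg_id].
  exact: exprn_continuous.
have cF (x : R) : {for x, continuous F}.
  by apply: differentiable_continuous; apply/derivable1_diffP; have [] := dF x.
rewrite Rintegral_itv_bndo_bndc; last first.
  apply: (@integrableS _ _ _ mu `[2^-1, s]%classic) => //.
    by apply: subset_itvl; rewrite bnd_simp.
  apply: continuous_compact_integrable; first exact: segment_compact.
  by apply: continuous_in_subspaceT => x _; exact: cf.
rewrite /Rintegral (@continuous_FTC2 _ _ F)//.
- rewrite -EFinB/= /F.
  have -> : (2 * k.+1%:R)^-1 * (2 * s) ^+ k.+1 = (2 * s) ^+ k / k.+1%:R * s.
    rewrite exprS; by field; rewrite nat1r pnatr_eq0.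
  have B0 : 0 <= (2 * k.+1%:R)^-1 * (2 / 2 : R) ^+ k.+1.
    by rewrite mulr_ge0 ?exprn_ge0 ?invr_ge0 ?mulr_ge0 ?ler0n.
  by rewrite lerBlDr (le_trans (ler_piMr F0 s1))// lerDl.
- apply: continuous_in_subspaceT => x _; exact: cf.
- split.
  + by move=> x _; have [] := dF x.
  + by apply: cvg_at_right_filter; apply: cF.
  + by apply: cvg_at_left_filter; apply: cF.
- by move=> x _; rewrite derive1E; have [_ ->] := dF x.
Qed.
End uniform.

(** * The one-step operator on survival functions *)
Section Psi.
Context {R : realType}.
Notation unif := (uniform_prob (@ltr01 R)).

(** If [p] is the survival function of a random [X] in [frozen_I], then [Psi p]
    is the survival function of [frozen_Phi X U] with [U] uniform and
    independent of [X]: indeed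
    [P(frozen_Phi X U <= s) = E(X; X <= s)
      = s (1 - p(s)) - int_{1/2}^s (1 - p(x)) dx].
    The integral is taken against the uniform probability on [[0, 1]], and the
    value is 0 away from [[1/2, 1]] to keep [Psi p] bounded. *)
Definition Psi (p : R -> R) (s : R) : R :=
  if s \in `[2^-1, 1] then
    2^-1 + s * p s - \int[unif]_x ((x \in `[2^-1, s[)%:R * p x)
  else 0.

(** Only the values on [[1/2, 1]] matter: below, a survival function on
    [frozen_I] is 1, and above it is constant. *)
Definition survival (p : R -> R) : Prop :=
  (forall x, 2^-1 <= x <= 1 -> 0 <= p x <= 1) /\
  (forall x y, 2^-1 <= x -> x <= y -> y <= 1 -> p y <= p x).

(** Monotonicity is preserved because
    [Psi p x - Psi p y >= x (p x - p y)] for [x <= y]; the bounds then follow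
    from [Psi p (1/2) <= 1] and [0 <= Psi p 1]. *)
Lemma Psi_survival p : bounded_measurable p -> survival p -> survival (Psi p).
Proof.
move=> bp [p01 pd].
have bI (s : R) : bounded_measurable (fun x => (x \in `[2^-1, s[)%:R * p x).
  by apply: bm_mul => //; exact: bm_itv_co.
have mono x y : 2^-1 <= x -> x <= y -> y <= 1 -> Psi p y <= Psi p x.
  move=> x2 xy y1.
  have yI : y \in `[2^-1, 1] by rewrite in_itv/= y1 (le_trans x2 xy).
  have xI : x \in `[2^-1, 1] by rewrite in_itv/= x2 (le_trans xy y1).
  rewrite /Psi xI yI.
  have : \int[unif]_u ((u \in `[2^-1, x[)%:R * p u) + (y - x) * p y <=
         \int[unif]_u ((u \in `[2^-1, y[)%:R * p u).
    have bc : bounded_measurable (fun u : R => p y * (u \in `[x, y[)%:R).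
      by apply: bm_mul; [exact: bm_cst|exact: bm_itv_co].
    rewrite [leLHS](_ : _ = \int[unif]_u
      ((u \in `[2^-1, x[)%:R * p u + p y * (u \in `[x, y[)%:R)).
      apply: Rint_le; [exact: (bm_add (bI x) bc)|exact: bI|].
      move=> u; rewrite !in_itv/=; have [ux|ux] := ltP u x.
        by rewrite !(andbF, andbT)/= (lt_le_trans ux xy) andbT mulr0 addr0.
      rewrite !(andbF, andbT)/= mul0r add0r (le_trans x2 ux)/=.
      have [uy|uy] := ltP u y; last by rewrite mulr0 mul0r.
      by rewrite mulr1 mul1r; apply: pd => //;
        [exact: le_trans x2 ux|exact: ltW].
    rewrite (Rint_add unif (bI x) bc) (Rint_mulr unif (p y) (bm_itv_co x y)).
    by rewrite unif_itv_co//; [rewrite mulrC|lra].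
  have := pd _ _ x2 xy y1.
  have : 0 <= x by lra.
  nra.
have half : Psi p 2^-1 <= 1.
  rewrite /Psi in_itv/= lexx/= ifT; last by lra.
  rewrite (@eq_Rintegral _ _ _ _ _ (fun=> 0)); last first.
    by move=> x _; rewrite in_itv/= leNgt andNb mul0r.
  by have := p01 2^-1; rewrite Rint_cst; lra.
have one : 0 <= Psi p 1.
  rewrite /Psi in_itv/= lexx andbT ifT; last by lra.
  have : \int[unif]_x ((x \in `[2^-1, 1[)%:R * p x) <= 2^-1.
    apply: (@le_trans _ _ (\int[unif]_x (x \in `[2^-1, 1[)%:R)); last first.
      by rewrite unif_itv_co//; lra.
    apply: Rint_le; [exact: bI|exact: bm_itv_co|].
    move=> x; case: (boolP (x \in _)); last by rewrite mul0r.
    by rewrite in_itv/= mul1r => /andP[x2 /ltW x1]; have := p01 x;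
      rewrite x2 x1; lra.
  by have := p01 1; lra.
split=> // x /andP[x2 x1]; apply/andP; split.
- by apply: le_trans one _; apply: mono.
- by apply: le_trans half; apply: mono.
Qed.

Lemma bm_Psi_integrand d (T : measurableType d) (p : R * T -> R) :
  bounded_measurable p ->
  bounded_measurable (fun z : (R * T) * R =>
    (z.2 \in `[2^-1, z.1.1[)%:R * p (z.2, z.1.2)).
Proof.
move=> bp; apply: bm_mul.
  apply: bm_bool.
  have -> : (fun z : (R * T) * R => z.2 \in `[2^-1, z.1.1[) =
            (fun z => (2^-1 <= z.2) && (z.2 < z.1.1)).
    by apply/funext => z; rewrite in_itv.
  apply: measurable_and; first exact: measurable_fun_ler.
  apply: measurable_fun_ltr => //.
  exact: (measurableT_comp measurable_fst measurable_fst).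
apply: (@bm_comp _ _ _ _ _ (fun z : (R * T) * R => (z.2, z.1.2)) p) => //.
apply: measurable_fun_pair => //.
exact: (measurableT_comp measurable_snd measurable_fst).
Qed.

Lemma bm_Psi d (T : measurableType d) (p : R * T -> R) : bounded_measurable p ->
  bounded_measurable (fun z : R * T => Psi (fun x => p (x, z.2)) z.1).
Proof.
move=> bp.
have mdom : measurable_fun setT (fun z : R * T => z.1 \in `[2^-1, 1]).
  have -> : (fun z : R * T => z.1 \in `[2^-1, 1]) =
            (fun z => (2^-1 <= z.1) && (z.1 <= 1)).
    by apply/funext => z; rewrite in_itv.
  by apply: measurable_and; exact: measurable_fun_ler.
have bdom := @bm_bool R _ _ _ mdom.
have bsdom : bounded_measurable
    (fun z : R * T => (z.1 \in `[2^-1, 1])%:R * z.1).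
  split; first by apply: measurable_funM => //; exact: bdom.1.
  have h (x : R) : `|(x \in `[2^-1, 1])%:R * x| <= 1.
    rewrite normrM; case: (boolP (x \in _)); last by rewrite normr0 mul0r.
    rewrite in_itv/= normr1 mul1r => /andP[x2 x1].
    by rewrite ger0_norm//; lra.
  by exists 1 => z.
have bJ := bm_Rint unif (bm_Psi_integrand bp).
have -> : (fun z : R * T => Psi (fun x => p (x, z.2)) z.1) =
    (fun z => (z.1 \in `[2^-1, 1])%:R * (2^-1 - \int[unif]_x
        ((x \in `[2^-1, z.1[)%:R * p (x, z.2))) +
      ((z.1 \in `[2^-1, 1])%:R * z.1) * p z).
  apply/funext => -[s w]; rewrite /Psi/=; case: ifP => _;
    last by rewrite !mul0r addr0.
  by rewrite !mul1r addrAC.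
apply: bm_add; last exact: bm_mul.
apply: bm_mul => //; apply: bm_sub => //; exact: bm_cst.
Qed.

Lemma bm_itv_mul (p : R -> R) (s : R) : bounded_measurable p ->
  bounded_measurable (fun x => (x \in `[2^-1, s[)%:R * p x).
Proof. by move=> bp; apply: bm_mul => //; exact: bm_itv_co. Qed.

(** [Psi] is affine, so it commutes with expectations weighted by [h]; only the
    integral term needs Fubini. *)
Lemma Psi_expectation d (T : measurableType d) (P : probability T R)
    (h : T -> R) (p : R * T -> R) (s : R) :
  bounded_measurable h -> bounded_measurable p -> 2^-1 <= s <= 1 ->
  \int[P]_w (h w * Psi (fun x => p (x, w)) s) =
    2^-1 * (\int[P]_w h w) + s * (\int[P]_w (h w * p (s, w))) -
    \int[unif]_x ((x \in `[2^-1, s[)%:R * \int[P]_w (h w * p (x, w))).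
Proof.
move=> bh bp s01.
pose J w := \int[unif]_x ((x \in `[2^-1, s[)%:R * p (x, w)).
have bg : bounded_measurable (fun z : R * T =>
    (z.1 \in `[2^-1, s[)%:R * (h z.2 * p z)).
  apply: bm_mul; first by apply: (bm_comp _ (bm_itv_co 2^-1 s)).
  by apply: bm_mul => //; apply: (bm_comp _ bh).
have bJ : bounded_measurable J.
  have mz := @pair1_measurable _ _ (measurableTypeR R) T s.
  exact: (bm_comp mz (bm_Rint unif (bm_Psi_integrand bp))).
have bhp x : bounded_measurable (fun w => h w * p (x, w)).
  by apply: bm_mul => //; exact: bm_slice2.
have -> : \int[P]_w (h w * Psi (fun x => p (x, w)) s) =
    \int[P]_w (2^-1 * h w + s * (h w * p (s, w)) - h w * J w).
  apply: eq_Rintegral => w _; rewrite /Psi in_itv/= s01 -/(J w); ring.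
have b1 : bounded_measurable (fun w => 2^-1 * h w) by apply: bm_mul => //;
  exact: bm_cst.
have b2 : bounded_measurable (fun w => s * (h w * p (s, w))).
  by apply: bm_mul => //; exact: bm_cst.
rewrite Rint_sub; [|exact: bm_add|exact: bm_mul].
rewrite Rint_add// !Rint_mulr//; congr (_ - _).
transitivity (\int[P]_w \int[unif]_x
  ((x \in `[2^-1, s[)%:R * (h w * p (x, w)))).
  apply: eq_Rintegral => w _; rewrite -Rint_mulr; last first.
    by apply: bm_itv_mul; exact: bm_slice1.
  by apply: eq_Rintegral => x _; ring.
rewrite -(Rint_fubini unif P bg); apply: eq_Rintegral => x _.
by rewrite /= (Rint_mulr P _ (bhp x)).
Qed.

(** The survival function of a constant [x] is an indicator; [Psi] applied to
    it is 1 when [s < x] and [1 - x], the probability that the innovation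
    exceeds [x], when [x <= s]. *)
Lemma Phi_Psi (x : \bar R) (s : R) : frozen_I x -> 2^-1 <= s <= 1 ->
  \int[unif]_u (s%:E < frozen_Phi x u)%E%:R = Psi (fun t => (t%:E < x)%E%:R) s.
Proof.
move=> Ix /andP[s2 s1]; rewrite /Psi in_itv/= s2 s1/=.
have large : (s%:E < x)%E ->
    2^-1 + s * (s%:E < x)%E%:R -
    \int[unif]_t ((t \in `[2^-1, s[)%:R * (t%:E < x)%E%:R) = 1.
  move=> sx; rewrite sx mulr1.
  have -> : \int[unif]_t ((t \in `[2^-1, s[)%:R * (t%:E < x)%E%:R) = s - 2^-1.
    rewrite -unif_itv_co ?invr_ge0//.
    apply: eq_Rintegral => t _; case: (boolP (t \in _)); last by rewrite mul0r.
    rewrite in_itv/= => /andP[_ ts].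
    by rewrite (lt_trans _ sx) ?lte_fin// mulr1.
  lra.
have [sx|xs] := ltP s%:E x.
  rewrite sx in large; rewrite large//.
  rewrite -[RHS](Rint_cst unif); apply: eq_Rintegral => u _.
  by rewrite /frozen_Phi; case: ifP => _; rewrite ?sx ?ltry.
case: Ix xs => [|-> //]; case: x large => // r _ /andP[].
rewrite !lee_fin => r2 r1 rs.
rewrite mulr0 addr0.
have -> : \int[unif]_t ((t \in `[2^-1, s[)%:R * (t%:E < r%:E)%E%:R) = r - 2^-1.
  rewrite -unif_itv_co ?invr_ge0//.
  apply: eq_Rintegral => t _; rewrite !in_itv/= lte_fin.
  have [tr|_] := ltP t r; last by rewrite mulr0 andbF.
  by rewrite (lt_le_trans tr rs) mulr1.
have bl : bounded_measurable (fun u : R => (u < r)%R%:R : R).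
  by apply: bm_bool; exact: measurable_fun_ltr.
transitivity (\int[unif]_u (1 - (u < r)%R%:R)).
  apply: eq_Rintegral => u _; rewrite /frozen_Phi lte_fin.
  by case: ifP => _; rewrite ?subr0 ?ltry// lte_fin ltNge rs subrr.
rewrite Rint_sub//; last exact: bm_cst.
rewrite Rint_cst unif_lt; first lra.
by apply/andP; split; lra.
Qed.

(** With [q = p - c], the difference is [s q(s) - int_{1/2}^s q], whose square is
    at most [7/6 (s q(s))^2 + 7 (int q)^2].  The first term contributes
    [7/6 * 3/4 = 7/8].  For the second, [E q(x)^2] is at most 3 times the weight
    because [x >= 1/2], and integration divides by 336, which leaves
    [7 * 3 / 336 = 1/16].  The exponent 335 is chosen to make the sum
    [15/16]. *)
Lemma Psi_variance d (T : measurableType d) (P : probability T R)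
    (p : R * T -> R) (c : R -> R) (s C : R) :
  bounded_measurable p -> bounded_measurable c -> 2^-1 <= s <= 1 -> 0 <= C ->
  (forall x, 2^-1 <= x <= s ->
    x ^+ 2 * (\int[P]_w ((p (x, w) - c x) ^+ 2)) <=
      3 / 4 * (C * (2 * x) ^+ 335)) ->
  \int[P]_w ((Psi (fun x => p (x, w)) s - Psi c s) ^+ 2) <=
    15 / 16 * (C * (2 * s) ^+ 335).
Proof.
move=> bp bc s01 C0 hq; have /andP[s2 s1] := s01.
set k := 335%N in hq *.
pose q z := p z - c z.1.
have bq : bounded_measurable q.
  by apply: bm_sub => //; exact: (bm_comp _ bc).
have bq2 : bounded_measurable (fun z => q z ^+ 2) by exact: bm_sqr.
pose J w := \int[unif]_x ((x \in `[2^-1, s[)%:R * q (x, w)).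
have mz := @pair1_measurable _ _ (measurableTypeR R) T s.
have bJ : bounded_measurable J :=
  bm_comp mz (bm_Rint unif (bm_Psi_integrand bq)).
pose J2 w := \int[unif]_x ((x \in `[2^-1, s[)%:R * q (x, w) ^+ 2).
have bJ2 : bounded_measurable J2 :=
  bm_comp mz (bm_Rint unif (bm_Psi_integrand bq2)).
have bqs : bounded_measurable (fun w => q (s, w)) by exact: bm_slice2.
have PsiE w : Psi (fun x => p (x, w)) s - Psi c s = s * q (s, w) - J w.
  rewrite /Psi in_itv/= s01 /J.
  rewrite (_ : \int[unif]_x ((x \in `[2^-1, s[)%:R * q (x, w)) =
     \int[unif]_x ((x \in `[2^-1, s[)%:R * p (x, w)) -
     \int[unif]_x ((x \in `[2^-1, s[)%:R * c x)); first by rewrite /q/=; ring.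
  rewrite -Rint_sub; [|apply: bm_itv_mul; exact: bm_slice1|exact: bm_itv_mul].
  by apply: eq_Rintegral => x _; rewrite /q mulrBr.
have J2le w : J w ^+ 2 <= J2 w.
  rewrite (le_trans (Rint_sqr _ _))//.
    by apply: bm_itv_mul; exact: bm_slice1.
  rewrite le_eqVlt; apply/orP; left; apply/eqP; apply: eq_Rintegral => x _.
  by case: (x \in _); rewrite ?mul1r// !mul0r expr0n.
have bqs2 : bounded_measurable (fun w => (7 / 6 * s ^+ 2) * q (s, w) ^+ 2).
  by apply: bm_mul; [exact: bm_cst|exact: bm_sqr].
have b7 : bounded_measurable (fun w => 7 * J2 w).
  by apply: bm_mul => //; exact: bm_cst.
apply: (@le_trans _ _
  (\int[P]_w ((7 / 6 * s ^+ 2) * q (s, w) ^+ 2 + 7 * J2 w))).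
  apply: Rint_le; [|exact: bm_add|].
    have -> : (fun w => (Psi (fun x => p (x, w)) s - Psi c s) ^+ 2) =
              (fun w => (s * q (s, w) - J w) ^+ 2).
      by apply/funext => w; rewrite PsiE.
    apply: bm_sqr; apply: bm_sub => //; apply: bm_mul => //; exact: bm_cst.
  move=> w; rewrite PsiE.
  (* 7/6 a^2 + 7 b^2 - (a - b)^2 = (a + 6 b)^2 / 6 *)
  have := J2le w; have := sqr_ge0 (s * q (s, w) + 6 * J w); nra.
rewrite Rint_add// !Rint_mulr//; last exact: bm_sqr.
have hs := hq s; rewrite s2 lexx in hs; have {}hs := hs isT.
have aux (y I K : R) : 2^-1 <= y -> 0 <= K -> 0 <= I ->
    y ^+ 2 * I <= 3 / 4 * K -> I <= 3 * K.
  move=> y2 K0 I0 hI; have y4 : 0 <= I * (y ^+ 2 - 4^-1).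
    by rewrite mulr_ge0// subr_ge0; nra.
  by lra.
have hJ : \int[P]_w J2 w <= (3 * C) * ((2 * s) ^+ k / k.+1%:R).
  have bg : bounded_measurable (fun z : R * T =>
    (z.1 \in `[2^-1, s[)%:R * q z ^+ 2).
    by apply: bm_mul => //; exact: (bm_comp _ (bm_itv_co 2^-1 s)).
  rewrite /J2 -(Rint_fubini unif P bg)/=.
  apply: le_trans (ler_wpM2l _ (itv_pow_integral k s01)); last by lra.
  rewrite -Rint_mulr; last exact: itv_pow_bm.
  apply: Rint_le; first exact: (bm_Rint P bg).
    by apply: bm_mul; [exact: bm_cst|exact: itv_pow_bm].
  move=> x; rewrite Rint_mulr; last by apply: bm_sqr; exact: bm_slice2.
  case: (boolP (x \in _)) => [|_]; last by rewrite !mul0r mulr0.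
  rewrite in_itv/= => /andP[x2 /ltW xs]; rewrite !mul1r.
  have := hq x; rewrite x2 xs => /(_ isT).
  have : 0 <= \int[P]_w ((p (x, w) - c x) ^+ 2).
    by apply: Rintegral_ge0 => w _; exact: sqr_ge0.
  have : 0 <= C * (2 * x) ^+ k by rewrite mulr_ge0// exprn_ge0//; lra.
  by move=> K0 I0 hI; rewrite -[leRHS]mulrA; exact: (aux x).
move: hs hJ; rewrite /q/= /k; set I2 := \int[P]_w _; set K := (2 * s) ^+ _.
lra.
Qed.
End Psi.

(** * Conditional survival functions given a deep level *)
Lemma measurable_lte_bool d (T : measurableType d) (R : realType)
    (f g : T -> \bar R) : measurable_fun setT f -> measurable_fun setT g ->
  measurable_fun setT (fun x => (f x < g x)%E).
Proof.
move=> mf mg; apply: (measurable_fun_bool true).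
have -> : (fun x => (f x < g x)%E) @^-1` [set true] = [set x | (f x < g x)%E].
  by apply/seteqP; split=> x /=.
exact: measurable_lte.
Qed.

Lemma measurable_frozen_Phi (R : realType) :
  measurable_fun setT (fun xu : \bar R * R => frozen_Phi xu.1 xu.2).
Proof.
rewrite /frozen_Phi; apply: measurable_fun_ifT => //.
by apply: measurable_lte_bool => //; exact/measurable_EFinP.
Qed.

Section frozen_process.
Context {R : realType} {d : measure_display} {T : measurableType d}
  (P : probability T R)
  (U : vertex -> {RV P >-> R}) (Y : vertex -> {RV P >-> \bar R})
  (hU : innovation_process P U)
  (hY : invariant_rtp P frozen_I frozen_Phi frozen_nu U Y).
Notation unif := (uniform_prob (@ltr01 R)).
Notation c0 i := (rcons i false).
Notation c1 i := (rcons i true).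

Definition below (i : vertex) (m : nat) : set vertex :=
  [set j | exists v : vertex, size v = m /\ j = i ++ v].

(** Vertices whose value does not depend on the innovations of the first [m]
    generations below [i].  This is the information in presence of which
    the value at [i] is still best predicted by the [m]-th generation below
    it. *)
Definition shielded (i : vertex) (m : nat) : set vertex :=
  [set j | forall v : vertex, (size v < m)%N -> ~~ prefix j (i ++ v)].

Lemma below_child i b m : below (rcons i b) m `<=` below i m.+1.
Proof.
by move=> j [v [vm ->]]; exists (b :: v); split; rewrite /= ?vm// cat_rcons.
Qed.

Lemma shielded_child i b m : shielded i m.+1 `<=` shielded (rcons i b) m.
Proof. by move=> j oj v vm; rewrite cat_rcons; exact: oj. Qed.

Lemma prefix_sibling (i v w : vertex) b :
  ~~ prefix (i ++ b :: w) (i ++ ~~ b :: v).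
Proof.
elim: i => [|c i ih] /=; first by case: b.
by rewrite eqxx.
Qed.

Lemma below_sibling i b m n :
  below (rcons i b) m `<=` shielded (rcons i (~~ b)) n.
Proof.
by move=> j [v [_ ->]] w _; rewrite !cat_rcons; exact: prefix_sibling.
Qed.

(** A version of the conditional probability that [Y i] exceeds the threshold
    [z.1] given the values [m] generations below [i].  The explicit recursion
    makes it jointly measurable in the threshold and the sample point, which
    integration over thresholds requires. *)
Fixpoint cond_survival (m : nat) (i : vertex) (z : R * T) : R :=
  if m is m'.+1 then
    Psi (fun x => cond_survival m' (c0 i) (x, z.2) *
                  cond_survival m' (c1 i) (x, z.2)) z.1
  else (z.1%:E < Y i z.2)%E%:R.
Notation Z := cond_survival.

Definition bm_wrt (F : set (set T)) (f : T -> R) :=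
  @bounded_measurable R _ (g_sigma_algebraType F) f.

Definition bm_joint (F : set (set T)) (f : R * T -> R) :=
  @bounded_measurable R _ (measurableTypeR R * g_sigma_algebraType F)%type f.

Lemma bm_joint_sub F G f : F `<=` <<s G >> -> bm_joint F f -> bm_joint G f.
Proof.
move=> FG; apply: (@bm_comp _ _ (measurableTypeR R * g_sigma_algebraType F)%type _
  (measurableTypeR R * g_sigma_algebraType G)%type id).
have mid : measurable_wrt G (id : T -> g_sigma_algebraType F).
  move=> mT B mB; rewrite setTI; move: mB; rewrite /measurable/=.
  by apply: smallest_sub => //; exact: smallest_sigma_algebra.
have -> : (id : R * T -> R * T) = (fun z => (z.1, z.2)) by apply/funext => -[].
apply: (@measurable_fun_pair _ _ _
  (measurableTypeR R * g_sigma_algebraType G)%type _ (g_sigma_algebraType F)).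
  exact: measurable_fst.
exact: (measurableT_comp mid measurable_snd).
Qed.

Lemma bm_joint_measurable F f : F `<=` measurable -> bm_joint F f ->
  bounded_measurable f.
Proof.
move=> Fm; apply: (@bm_comp _ _ (measurableTypeR R * g_sigma_algebraType F)%type _
  (measurableTypeR R * T)%type id).
have mid : measurable_fun setT (id : T -> g_sigma_algebraType F).
  move=> mT B mB; rewrite setTI; move: mB; rewrite /measurable/=.
  by apply: smallest_sub => //; exact: sigma_algebra_measurable.
have -> : (id : R * T -> R * T) = (fun z => (z.1, z.2)) by apply/funext => -[].
apply: (@measurable_fun_pair _ _ _
  (measurableTypeR R * T)%type _ (g_sigma_algebraType F)).
  exact: measurable_fst.
exact: (measurableT_comp mid measurable_snd).
Qed.

Lemma bm_wrt_measurable F f : F `<=` measurable -> bm_wrt F f ->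
  bounded_measurable f.
Proof.
by move=> Fm [mf bf]; split => //; exact: (measurable_wrt_measurable Fm).
Qed.

Lemma bm_wrt_sub F G f : F `<=` <<s G >> -> bm_wrt F f -> bm_wrt G f.
Proof.
by move=> FG [mf bf]; split => //; exact: (measurable_wrt_sub FG).
Qed.

Notation sY D := (sigma_rv P D Y).

Lemma sigma_Y_sub (D D' : set vertex) : D `<=` D' -> sY D `<=` <<s sY D' >>.
Proof.
by move=> DD; apply: subset_trans (@sub_sigma_algebra _ _ _);
  exact: sigma_rv_sub.
Qed.

Lemma bm_cond_survival_joint m i : bm_joint (sY (below i m)) (Z m i).
Proof.
elim: m i => [|m ih] i /=.
  apply: bm_bool; apply: measurable_lte_bool.
    by apply/measurable_EFinP; exact: measurable_fst.
  have mY : measurable_wrt (sY (below i 0)) (Y i).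
    by apply: measurable_wrt_rv; exists [::]; rewrite cats0.
  exact: (measurableT_comp mY measurable_snd).
apply: (@bm_Psi _ _ (g_sigma_algebraType (sY (below i m.+1)))
  (fun z => Z m (c0 i) z * Z m (c1 i) z)).
by apply: bm_mul; apply: bm_joint_sub (ih _); apply: sigma_Y_sub;
  exact: below_child.
Qed.

Lemma bm_cond_survival m i : bounded_measurable (Z m i).
Proof.
exact: bm_joint_measurable sigma_rv_measurable (bm_cond_survival_joint m i).
Qed.

Lemma bm_cond_survival_at m i s :
  bm_wrt (sY (below i m)) (fun w => Z m i (s, w)).
Proof.
exact: (@bm_slice2 R _ _ (measurableTypeR R) _ _ _
  (bm_cond_survival_joint m i)).
Qed.

Lemma bm_cond_survival_mul m i :
  bounded_measurable (fun z => Z m (c0 i) z * Z m (c1 i) z).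
Proof. by apply: bm_mul; exact: bm_cond_survival. Qed.

Lemma cond_survivalP m i w : survival (fun x => Z m i (x, w)).
Proof.
elim: m i => [|m ih] i /=.
  split=> [x _|x y _ xy _]; first by case: (_ < _)%E; rewrite !lexx ler01.
  rewrite ler_nat; case: (boolP (y%:E < Y i w)%E) => // yY.
  by rewrite (le_lt_trans _ yY)// lee_fin.
apply: Psi_survival; first by apply: (@bm_slice1 R _ _ _ _ _ w
  (bm_cond_survival_mul m i)).
have [z01 zd] := ih (c0 i); have [z01' zd'] := ih (c1 i).
split=> [x x01|x y x2 xy y1].
  have /andP[a0 a1] := z01 x x01; have /andP[b0 b1] := z01' x x01.
  by rewrite mulr_ge0//= -[leRHS]mulr1 ler_pM.
have /andP[y0 _] := z01 y (introT andP (conj (le_trans x2 xy) y1)).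
have /andP[y0' _] := z01' y (introT andP (conj (le_trans x2 xy) y1)).
by rewrite ler_pM//; [exact: zd|exact: zd'].
Qed.

(** The uniform law lives on the sigma-algebra generated by half-open intervals,
    whose canonical structure is not the one carried by [U i]; the two have the
    same measurable sets, so [U i] is first viewed as valued in the former. *)
Lemma innovation_law i (g : R -> R) : bounded_measurable g ->
  \int[P]_w g (U i w) = \int[unif]_u g u.
Proof.
move=> bg.
have mU : @measurable_fun _ _ T (measurableTypeR R) setT (U i).
  by move=> mT B mB; exact: (@measurable_funP _ _ _ _ setT (U i) mT B mB).
pose V : {mfun T >-> measurableTypeR R} :=
  HB.pack (U i : T -> measurableTypeR R) (isMeasurableFun.Build _ _ _ _ _ mU).
have -> : \int[unif]_u g u = \int[distribution P V]_u g u.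
  rewrite /Rintegral; congr fine; apply: eq_measure_integral => A mA _.
  exact/esym/hU.2.
rewrite /Rintegral integral_distribution//; first by apply/measurable_EFinP;
  exact: bg.1.
exact/bm_integrable/(bm_comp (measurable_funP (U i)) bg).
Qed.

Lemma frozen_I_min (x y : \bar R) : frozen_I x -> frozen_I y ->
  frozen_I (Order.min x y).
Proof. by move=> Ix Iy; rewrite /Order.min; case: ifP. Qed.

(** [U i] is independent of everything shielded from it, in particular of [h]
    and of the two children; integrating it out first replaces the indicator by
    [Psi] of the indicator of the minimum of the children. *)
Lemma one_step i s h : bm_wrt (sY (shielded i 1)) h -> 2^-1 <= s <= 1 ->
  \int[P]_w (h w * (s%:E < Y i w)%E%:R) = \int[P]_w (h w * Z 1 i (s, w)).
Proof.
move=> bh s01.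
have bhT : bounded_measurable h.
  exact: bm_wrt_measurable sigma_rv_measurable bh.
pose X w := Order.min (Y (c0 i) w) (Y (c1 i) w).
have IX w : frozen_I (X w) by apply: frozen_I_min; exact: (rtp_valued hY).
have shielded_of_child b : shielded i 1 (rcons i b).
  by case=> // _; rewrite cats0; apply/negP => /size_prefix;
    rewrite size_rcons ltnn.
have mX : measurable_wrt (sY (shielded i 1)) X.
  by apply: (@measurable_mine _ (g_sigma_algebraType (sY (shielded i 1))) R
    setT);
    exact: measurable_wrt_rv.
(* first coordinate: what is shielded from [U i]; second coordinate: [U i] *)
pose f (z : T * T) := h z.1 * (s%:E < frozen_Phi (X z.1) (U i z.2))%E%:R.
have mU : measurable_wrt (sigma_rv P [set i] U) (U i).
  by apply: measurable_wrt_rv.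
have mUT : measurable_fun setT (U i) by exact: measurable_funP.
have mXT : measurable_fun setT X.
  exact: measurable_wrt_measurable sigma_rv_measurable mX.
have bf : @bounded_measurable R _ (g_sigma_algebraType (sY (shielded i 1)) *
    g_sigma_algebraType (sigma_rv P [set i] U))%type f.
  apply: bm_mul; first exact: (bm_comp measurable_fst bh).
  apply: bm_bool; apply: measurable_lte_bool => //.
  exact: (measurableT_comp (@measurable_frozen_Phi R) (measurable_fun_pair
    (measurableT_comp mX measurable_fst) (measurableT_comp mU measurable_snd))).
have ind : independent_sigma P (sY (shielded i 1)) (sigma_rv P [set i] U).
  apply: (independent_innovations (@measurable_frozen_Phi R) hU hY) =>
    j v oj /= jv.
  by have := oj [::] isT; rewrite cats0 -jv prefix_prefix.
have bYs : bounded_measurable (fun w => (s%:E < Y i w)%E%:R : R).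
  by apply: bm_bool; apply: measurable_lte_bool => //; exact: measurable_funP.
have bfd : bounded_measurable (fun w => f (w, w)).
  apply: bm_mul => //; apply: bm_bool; apply: measurable_lte_bool => //.
  exact: (measurableT_comp (@measurable_frozen_Phi R)
    (measurable_fun_pair mXT mUT)).
transitivity (\int[P]_w f (w, w)).
  apply: Rint_ae_eq => //; first exact: bm_mul.
  by apply: filterS (rtp_rec hY i) => w Yi; rewrite Yi.
rewrite (independent_fubini sigma_rv_algebra sigma_rv_measurable
   sigma_rv_algebra sigma_rv_measurable ind bf).
apply: eq_Rintegral => w _; rewrite /f/=.
have bPhi : bounded_measurable
    (fun u : R => (s%:E < frozen_Phi (X w) u)%E%:R : R).
  apply: bm_bool; apply: measurable_lte_bool => //.
  exact: (measurableT_comp (@measurable_frozen_Phi R)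
    (@pair1_measurable _ _ _ (measurableTypeR R) (X w))).
rewrite Rint_mulr; last exact: (bm_comp mUT bPhi).
congr (_ * _); rewrite (innovation_law i bPhi) Phi_Psi//; congr Psi.
by apply/funext => x; rewrite /X lt_min; case: (_ < _)%E; case: (_ < _)%E;
  rewrite ?mulr1 ?mulr0.
Qed.

Lemma shielded_sub i m n : (m <= n)%N -> shielded i n `<=` shielded i m.
Proof. by move=> mn j oj v vm; apply: oj; exact: leq_trans mn. Qed.

(** The defining property of a conditional probability, tested against any [h]
    shielded from the first [m] generations.  After one step, the two children
    are replaced one at a time: the indicator of one child, and afterwards the
    conditional probability of the other, is shielded from the subtree of its
    sibling and can be absorbed into the test function. *)
Lemma cond_survival_expectation m i s h : bm_wrt (sY (shielded i m)) h ->
  2^-1 <= s <= 1 ->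
  \int[P]_w (h w * (s%:E < Y i w)%E%:R) = \int[P]_w (h w * Z m i (s, w)).
Proof.
elim: m i s h => [//|m ih] i s h bh s01.
have bh1 : bm_wrt (sY (shielded i 1)) h by apply: bm_wrt_sub bh;
  apply: sigma_Y_sub; exact: shielded_sub.
have bhT : bounded_measurable h.
  exact: bm_wrt_measurable sigma_rv_measurable bh.
have bhc b : bm_wrt (sY (shielded (rcons i b) m)) h.
  by apply: bm_wrt_sub bh; apply: sigma_Y_sub; exact: shielded_child.
have pair x : 2^-1 <= x <= 1 ->
    \int[P]_w (h w * (Z 0 (c0 i) (x, w) * Z 0 (c1 i) (x, w))) =
    \int[P]_w (h w * (Z m (c0 i) (x, w) * Z m (c1 i) (x, w))).
  move=> x01.
  transitivity (\int[P]_w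
    ((h w * Z 0 (c1 i) (x, w)) * (x%:E < Y (c0 i) w)%E%:R)).
    by apply: eq_Rintegral => w _ /=; ring.
  rewrite ih//; last first.
    apply: bm_mul; first exact: bhc.
    apply: bm_wrt_sub (bm_cond_survival_at 0 (c1 i) x); apply: sigma_Y_sub;
      exact: (@below_sibling i true).
  transitivity (\int[P]_w
    ((h w * Z m (c0 i) (x, w)) * (x%:E < Y (c1 i) w)%E%:R)).
    by apply: eq_Rintegral => w _ /=; ring.
  rewrite ih//; last first.
    apply: bm_mul; first exact: bhc.
    apply: bm_wrt_sub (bm_cond_survival_at m (c0 i) x); apply: sigma_Y_sub;
      exact: (@below_sibling i false).
  by apply: eq_Rintegral => w _ /=; ring.
rewrite (one_step bh1 s01).
rewrite (Psi_expectation P bhT (bm_cond_survival_mul 0 i) s01)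
  (Psi_expectation P bhT (bm_cond_survival_mul m i) s01).
congr (_ + _ - _); first by rewrite pair.
apply: eq_Rintegral => x _; case: (boolP (x \in _)); last by rewrite !mul0r.
rewrite in_itv/= => /andP[x2 xs]; rewrite pair// x2/=.
by move: s01 => /andP[_]; exact: le_trans (ltW xs).
Qed.

End frozen_process.

(** * The upper tail of nu *)
Section frozen_nu_tail.
Context {R : realType}.

(** The density [1 / (2 y^2)] has the antiderivative [- 1 / (2 y)], and the atom
    at infinity contributes [1/2]. *)
Lemma frozen_nu_ray (x : R) : 2^-1 <= x <= 1 ->
  fine (frozen_nu [set y | x%:E < y]%E) = (2 * x)^-1.
Proof.
move=> /andP[x2 x1]; have x0 : 0 < x by lra.
pose f (y : R) := (2 * y ^+ 2)^-1.
pose F (y : R) := - (2^-1 * y^-1).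
have dF (y : R) : 0 < y -> is_derive y 1 F (f y).
  move=> y0; have yn0 : y != 0 by rewrite gt_eqF.
  have h := is_deriveN (is_deriveZ (2^-1)
    (@is_deriveV R id y 1 1 yn0 (is_derive_id _ _))).
  by apply: is_derive_eq h _; rewrite /f /GRing.scale/=; field.
have cf (y : R) : 0 < y -> {for y, continuous f}.
  move=> y0; apply: cvgV; first by rewrite mulf_neq0// ?expf_neq0 ?gt_eqF.
  by apply: cvgM; [exact: cvg_cst|exact: exprn_continuous].
have cF (y : R) : 0 < y -> {for y, continuous F}.
  move=> y0; apply: differentiable_continuous; apply/derivable1_diffP.
  by have [] := dF y y0.
rewrite /frozen_nu diracE mem_set/= ?ltry// mule1.
have -> : `]2^-1, 1[%classic `&` EFin @^-1` [set y | x%:E < y]%E =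
    `]x, 1[%classic.
  apply/seteqP; split=> y /=; rewrite !in_itv/= lte_fin.
    by move=> [/andP[_ ->] ->].
  by move=> /andP[xy ->]; rewrite xy (le_lt_trans x2 xy).
have [{}x1|x1'] := ltP x 1; last first.
  have -> : x = 1 by lra.
  by rewrite set_itvoo0 integral_set0 add0e/= mulr1.
have mf : measurable_fun `]x, 1[ (EFin \o f).
  apply: measurableT_comp => //.
  apply: open_continuous_measurable_fun; first exact: interval_open.
  move=> y; rewrite inE/= in_itv/= => /andP[xy _].
  by apply: cf; exact: lt_trans xy.
rewrite integral_itv_bndoo//.
rewrite -(integral_itv_bndoo true false)//.
rewrite (@continuous_FTC2 _ _ F)//.
- by rewrite /F/=; field; rewrite gt_eqF.
- apply: continuous_in_subspaceT => y; rewrite inE/= in_itv/= => /andP[xy _].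
  by apply: cf; exact: lt_le_trans xy.
- split.
  + by move=> y; rewrite in_itv/= => /andP[xy _]; have [] :=
    dF y (lt_trans x0 xy).
  + by apply: cvg_at_right_filter; apply: cF.
  + by apply: cvg_at_left_filter; apply: cF.
- move=> y; rewrite in_itv/= => /andP[xy _].
  by rewrite derive1E; have [_ ->] := dF y (lt_trans x0 xy).
Qed.
End frozen_nu_tail.

(** * Decay of the variance and triviality of the tail *)
Section tail_triviality.
Context {R : realType} {d : measure_display} {T : measurableType d}
  (P : probability T R)
  (U : vertex -> {RV P >-> R}) (Y : vertex -> {RV P >-> \bar R})
  (hU : innovation_process P U)
  (hY : invariant_rtp P frozen_I frozen_Phi frozen_nu U Y).
Notation unif := (uniform_prob (@ltr01 R)).
Notation c0 i := (rcons i false).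
Notation c1 i := (rcons i true).
Notation sY D := (sigma_rv P D Y).
Notation Z := (cond_survival Y).

Definition nu_tail (x : R) : R :=
  fine (frozen_nu [set y : \bar R | x%:E < y]%E).

Lemma ray_measurable (x : R) : measurable [set y : \bar R | x%:E < y]%E.
Proof.
have -> : [set y : \bar R | x%:E < y]%E = `]x%:E, +oo[%classic.
  by apply/seteqP; split=> y /=; rewrite in_itv/= andbT.
exact: emeasurable_itv.
Qed.

Lemma indic_ray i x w : \1_(Y i @^-1` [set y | x%:E < y]%E) w = Z 0 i (x, w).
Proof.
rewrite indicE /=; congr (nat_of_bool _)%:R.
by apply/idP/idP; [move/set_mem|move=> ?; exact/mem_set].
Qed.

Lemma indicator_mean i x : \int[P]_w (Z 0 i (x, w)) = nu_tail x.
Proof.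
rewrite /nu_tail -(rtp_law hY i (ray_measurable x)).
rewrite -(Rint_indic P); last exact: measurable_preimage (ray_measurable x).
by apply: eq_Rintegral => w _; rewrite indic_ray.
Qed.

Lemma nu_tailE x : 2^-1 <= x <= 1 -> nu_tail x = (2 * x)^-1.
Proof. exact: frozen_nu_ray. Qed.

Lemma bm_nu_tail : bounded_measurable nu_tail.
Proof.
have -> : nu_tail = fun x => \int[P]_w (Z 0 [::] (x, w)).
  by apply/funext => x; rewrite indicator_mean.
exact: (bm_Rint P (bm_cond_survival Y 0 [::])).
Qed.

Lemma cond_survival_mean m i s : 2^-1 <= s <= 1 ->
  \int[P]_w Z m i (s, w) = nu_tail s.
Proof.
move=> s01; rewrite -(indicator_mean i).
have := cond_survival_expectation hU hY (bm_cst 1 :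
  bm_wrt (sY (shielded i m)) _) s01.
by under eq_Rintegral do rewrite mul1r;
  under [in X in _ = X -> _]eq_Rintegral do rewrite mul1r.
Qed.

Lemma bm_cond_survival_slice m i s : bounded_measurable (fun w => Z m i (s, w)).
Proof. exact: bm_slice2 (bm_cond_survival Y m i). Qed.

(** [Z] takes values in [[0, 1]], so its second moment is at most its mean. *)
Lemma cond_survival_sqr_mean m i s : 2^-1 <= s <= 1 ->
  \int[P]_w (Z m i (s, w) ^+ 2) <= nu_tail s.
Proof.
move=> s01; rewrite -(cond_survival_mean m i s01); apply: Rint_le.
- exact/bm_sqr/bm_cond_survival_slice.
- exact: bm_cond_survival_slice.
- move=> w; have [/(_ s s01)/andP[z0 z1] _] := cond_survivalP Y m i w.
  by rewrite expr2 ler_piMr.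
Qed.

(** Two families of vertices in disjoint subtrees, at the same level. *)
Lemma sibling_independent i m :
  independent_sigma P (sY (below (c0 i) m)) (sY (below (c1 i) m)).
Proof.
apply: (independent_blocks (rtp_indep hY (n := (size i + m).+1))).
- by move=> j [v [vm ->]]; rewrite /= size_cat size_rcons vm addSn.
- by move=> j [v [vm ->]]; rewrite /= size_cat size_rcons vm addSn.
- apply/seteqP; split=> // j [[v [vm ->]] [v' [vm']]].
  rewrite !cat_rcons => /eqP; rewrite eqseq_cat// => /andP[_ /eqP];
    discriminate.
Qed.

Lemma sibling_product i m (f g : T -> R) :
  bm_wrt (sY (below (c0 i) m)) f -> bm_wrt (sY (below (c1 i) m)) g ->
  \int[P]_w (f w * g w) = (\int[P]_w f w) * (\int[P]_w g w).
Proof.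
move=> bf bg.
have bgT : bounded_measurable g.
  exact: bm_wrt_measurable sigma_rv_measurable bg.
have bfT : bounded_measurable f.
  exact: bm_wrt_measurable sigma_rv_measurable bf.
have bfg : @bounded_measurable R _ (g_sigma_algebraType (sY (below (c0 i) m)) *
    g_sigma_algebraType (sY (below (c1 i) m)))%type (fun z => f z.1 * g z.2).
  apply: bm_mul; first exact: (bm_comp measurable_fst bf).
  exact: (bm_comp measurable_snd bg).
rewrite (independent_fubini sigma_rv_algebra sigma_rv_measurable
   sigma_rv_algebra sigma_rv_measurable
   (sibling_independent (i:=i) (m:=m)) bfg)/=.
rewrite mulrC -Rint_mulr//; apply: eq_Rintegral => w _.
by rewrite Rint_mulr// mulrC.
Qed.

(** Invariance of [nu]: this is the expectation of the one-step recursion at the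
    root. *)
Lemma nu_tail_Psi s : 2^-1 <= s <= 1 -> nu_tail s =
    Psi (fun x => nu_tail x ^+ 2) s.
Proof.
move=> s01.
have pr x : \int[P]_w (1 * (Z 0 (c0 [::]) (x, w) * Z 0 (c1 [::]) (x, w))) =
  nu_tail x ^+ 2.
  under eq_Rintegral do rewrite mul1r.
  by rewrite (sibling_product (bm_cond_survival_at Y 0 _ x)
    (bm_cond_survival_at Y 0 _ x)) !indicator_mean.
rewrite -(cond_survival_mean 1 [::] s01).
have := Psi_expectation P (bm_cst 1) (bm_cond_survival_mul Y 0 [::]) s01.
under eq_Rintegral do rewrite mul1r.
move=> ->; rewrite Rint_cst mulr1 /Psi in_itv/= s01 pr; congr (_ - _).
by apply: eq_Rintegral => x _; rewrite pr.
Qed.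

(** Write [a] and [b] for the second moments of the two siblings, [F] for their
    common mean and [K] for the variance bound.  By independence the variance of
    the product is [a b - F^4], and
    [a b - F^4 = b (a - F^2) + F^2 (b - F^2) <= (F + F^2) K] as [b <= F].
    Multiplied by [x^2], the factor is [x / 2 + 1 / 4 <= 3 / 4]. *)
Lemma cond_survival_variance m i s : 2^-1 <= s <= 1 ->
  \int[P]_w ((Z m i (s, w) - nu_tail s) ^+ 2) <=
    (15 / 16) ^+ m * (2 * s) ^+ 335.
Proof.
have varE n j x : 2^-1 <= x <= 1 ->
  \int[P]_w ((Z n j (x, w) - nu_tail x) ^+ 2) =
    \int[P]_w (Z n j (x, w) ^+ 2) - nu_tail x ^+ 2.
  move=> x01.
  have b1 : bounded_measurable (fun w => (2 * nu_tail x) * Z n j (x, w)).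
    by apply: bm_mul; [exact: bm_cst|exact: bm_cond_survival_slice].
  have b2 : bounded_measurable (fun w => Z n j (x, w) ^+ 2)
    by exact/bm_sqr/bm_cond_survival_slice.
  transitivity (\int[P]_w
    ((Z n j (x, w) ^+ 2 - (2 * nu_tail x) * Z n j (x, w)) + nu_tail x ^+ 2)).
    by apply: eq_Rintegral => w _; ring.
  rewrite Rint_add; [|exact: bm_sub|exact: bm_cst].
  rewrite Rint_sub// Rint_mulr; last exact: bm_cond_survival_slice.
  by rewrite Rint_cst cond_survival_mean//; ring.
elim: m i s => [|m ih] i s s01.
  rewrite varE// expr0 mul1r.
  apply: (@le_trans _ _ 1); last by rewrite exprn_ege1//; lra.
  have := cond_survival_sqr_mean 0 i s01; have := sqr_ge0 (nu_tail s).
  have : nu_tail s <= 1 by rewrite nu_tailE// invf_le1; lra.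
  lra.
have bp := bm_cond_survival_mul Y m i.
have bc := bm_sqr bm_nu_tail.
have C0 : 0 <= (15 / 16 : R) ^+ m by rewrite exprn_ge0//; lra.
rewrite (nu_tail_Psi s01) exprS -mulrA.
apply: (Psi_variance bp bc s01 C0) => x /andP[x2 xs].
have x01 : 2^-1 <= x <= 1 by rewrite x2/=; move: s01 => /andP[_];
  exact: le_trans.
set K := _ ^+ m * _.
have K0 : 0 <= K by rewrite mulr_ge0 ?exprn_ge0//; lra.
have v0 := ih (c0 i) x x01; have v1 := ih (c1 i) x x01.
rewrite varE// -/K in v0; rewrite varE// -/K in v1.
have a1 := cond_survival_sqr_mean m (c1 i) x01.
have a10 : 0 <= \int[P]_w (Z m (c1 i) (x, w) ^+ 2).
  by apply: Rintegral_ge0 => w _; exact: sqr_ge0.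
have -> : \int[P]_w ((Z m (c0 i) (x, w) * Z m (c1 i) (x, w) - nu_tail x ^+ 2)
    ^+ 2) =
    (\int[P]_w (Z m (c0 i) (x, w) ^+ 2)) *
      (\int[P]_w (Z m (c1 i) (x, w) ^+ 2)) -
    nu_tail x ^+ 4.
  have b1 : bounded_measurable (fun w =>
      (2 * nu_tail x ^+ 2) * (Z m (c0 i) (x, w) * Z m (c1 i) (x, w))).
    by apply: bm_mul; [exact: bm_cst|apply: bm_mul;
      exact: bm_cond_survival_slice].
  have b2 : bounded_measurable (fun w =>
    Z m (c0 i) (x, w) ^+ 2 * Z m (c1 i) (x, w) ^+ 2).
    by apply: bm_mul; exact/bm_sqr/bm_cond_survival_slice.
  transitivity (\int[P]_w ((Z m (c0 i) (x, w) ^+ 2 * Z m (c1 i) (x, w) ^+ 2 -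
      (2 * nu_tail x ^+ 2) * (Z m (c0 i) (x, w) * Z m (c1 i) (x, w))) + nu_tail
        x ^+ 4)).
    by apply: eq_Rintegral => w _; ring.
  rewrite Rint_add; [|exact: bm_sub|exact: bm_cst].
  rewrite Rint_sub// Rint_mulr; last by apply: bm_mul;
    exact: bm_cond_survival_slice.
  rewrite (sibling_product (bm_cond_survival_at Y m _ x)
    (bm_cond_survival_at Y m _ x)).
  rewrite (sibling_product (bm_sqr (bm_cond_survival_at Y m _ x))
    (bm_sqr (bm_cond_survival_at Y m _ x))).
  by rewrite !cond_survival_mean// Rint_cst; ring.
move: v0 v1 a1 a10.
set a := \int[P]_w _; set b := \int[P]_w _ => v0 v1 a1 a10.
have FE := nu_tailE x01; set F := nu_tail x in FE v0 v1 a1 *.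
have F0 : 0 <= F by rewrite FE invr_ge0; lra.
have xF : x * F = 2^-1 by rewrite FE; field; rewrite gt_eqF//; lra.
have step : a * b - F ^+ 4 <= (F + F ^+ 2) * K.
  have h1 : b * (a - F ^+ 2 - K) <= 0 by rewrite mulr_ge0_le0//; lra.
  have h2 : F ^+ 2 * (b - F ^+ 2 - K) <= 0 by rewrite mulr_ge0_le0 ?sqr_ge0//;
    lra.
  have h3 : (b - F) * K <= 0 by rewrite mulr_le0_ge0//; lra.
  lra.
apply: (@le_trans _ _ (x ^+ 2 * ((F + F ^+ 2) * K))).
  by rewrite ler_wpM2l ?sqr_ge0.
have -> : x ^+ 2 * ((F + F ^+ 2) * K) = (x * (x * F) + (x * F) ^+ 2) * K
  by ring.
rewrite xF ler_wpM2r//; move: x01 => /andP[_ x1]; lra.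
Qed.

Lemma geometric_limit (a K : R) : (forall m, a ^+ 2 <= (15 / 16) ^+ m * K) ->
  a = 0.
Proof.
move=> h; apply/eqP; rewrite -sqrf_eq0 eq_le sqr_ge0 andbT.
have c : ((15 / 16 : R) ^+ m * K) @[m --> \oo] --> 0 * K.
  apply: cvgM; last exact: cvg_cst.
  by apply: cvg_expr; rewrite ger0_norm; lra.
rewrite mul0r in c.
rewrite -(cvg_lim _ c)//; apply: limr_ge; first by apply/cvg_ex; exists 0.
by apply: nearW.
Qed.

(** The defect of independence does not depend on [m] when [Y i] is replaced by
    its conditional probability given generation [m], whose variance vanishes
    in the limit. *)
Lemma independent_ray (A : set T) i s : (forall m, sY (shielded i m) A) ->
  2^-1 <= s <= 1 -> \int[P]_w (\1_A w * Z 0 i (s, w)) = fine (P A) * nu_tail s.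
Proof.
move=> shA s01.
have mA : measurable A by exact: sigma_rv_measurable (shA 0%N).
have bA : bounded_measurable (\1_A : T -> R) by exact: bm_indic.
have bAm m : bm_wrt (sY (shielded i m)) (\1_A : T -> R).
  by apply: bm_indic; apply: sub_sigma_algebra; exact: shA.
apply/eqP; rewrite -subr_eq0; apply/eqP.
(* the left-hand side is the same for all m *)
apply: (geometric_limit (K := (2 * s) ^+ 335)) => m.
apply: le_trans (cond_survival_variance m i s01).
have bD : bounded_measurable (fun w => Z m i (s, w) - nu_tail s).
  by apply: bm_sub; [exact: bm_cond_survival_slice|exact: bm_cst].
have -> : \int[P]_w (\1_A w * Z 0 i (s, w)) - fine (P A) * nu_tail s =
    \int[P]_w (\1_A w * (Z m i (s, w) - nu_tail s)).
  rewrite (cond_survival_expectation hU hY (bAm m) s01) -Rint_indic// mulrC.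
  rewrite -Rint_mulr// -Rint_sub;
    [|by apply: bm_mul => //; exact: bm_cond_survival_slice|by apply: bm_mul =>
      //; exact: bm_cst].
  by apply: eq_Rintegral => w _; ring.
apply: le_trans (Rint_sqr P (bm_mul bA bD)) _.
apply: Rint_le; [exact/bm_sqr/bm_mul|exact: bm_sqr|move=> w].
rewrite indicE; case: (_ \in _); rewrite ?mul1r// mul0r expr0n/=;
  exact: sqr_ge0.
Qed.

(** Rays generate the Borel sets.  Thresholds outside [[1/2, 1]] reduce to the
    previous case since [Y i] takes values in [frozen_I]. *)
Lemma independent_of_shielded (A : set T) i : (forall m, sY (shielded i m) A) ->
  forall B, measurable B -> (P (Y i @^-1` B `&` A) = P (Y i @^-1` B) * P A)%E.
Proof.
move=> shA.
have mA : measurable A by exact: sigma_rv_measurable (shA 0%N).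
pose G := [set Y i @^-1` [set y | (x%:E < y)%E] | x in [set: R]].
have GI : setI_closed G.
  move=> _ _ [x _ <-] [y _ <-]; exists (Order.max x y) => //.
  by apply/seteqP; split=> w /=; rewrite EFin_max gt_max => /andP.
have Gm : G `<=` measurable.
  by move=> _ [x _ <-]; exact: measurable_preimage (ray_measurable x).
move=> B mB; apply: (independent_generator GI Gm mA); last first.
  have mYG : @measurable_fun _ _ (g_sigma_algebraType G) _ setT (Y i).
    apply: (measurability _ (ErealGenOInfty.measurableE R)) => _ [_ [x ->] <-].
    rewrite setTI; apply: sub_sigma_algebra; exists x => //.
    by apply/seteqP; split=> w /=; rewrite in_itv/= andbT.
  by rewrite -[X in _ X]setTI; exact: mYG.
move=> _ [x _ <-].
set E := Y i @^-1` _.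
have mE : measurable E by exact: measurable_preimage (ray_measurable x).
have key s : 2^-1 <= s <= 1 ->
    P (Y i @^-1` [set y | (s%:E < y)%E] `&` A) =
    (P (Y i @^-1` [set y | (s%:E < y)%E]) * P A)%E.
  move=> s01; set Es := Y i @^-1` _.
  have mEs : measurable Es by exact: measurable_preimage (ray_measurable s).
  have mEA : measurable (Es `&` A) by exact: measurableI.
  have IE w : \1_Es w = Z 0 i (s, w) :> R by rewrite indic_ray.
  rewrite -[LHS]fineK ?fin_num_measure// -[P Es]fineK ?fin_num_measure//.
  rewrite -[P A]fineK ?fin_num_measure// -EFinM; congr EFin.
  rewrite -(Rint_indic P mEA) -(Rint_indic P mEs).
  transitivity (\int[P]_w (\1_A w * Z 0 i (s, w))).
    by apply: eq_Rintegral => w _; rewrite indicI/= IE mulrC.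
  rewrite (independent_ray shA s01) mulrC -(indicator_mean i); congr (_ * _).
  by apply: eq_Rintegral => w _; rewrite IE.
have [x2|x2] := ltP x 2^-1.
  have -> : E = setT.
    apply/seteqP; split=> // w _; rewrite /E/=.
    case: (rtp_valued hY i w) => [/andP[h _]|->]; last by rewrite ltry.
    by apply: lt_le_trans h; rewrite lte_fin.
  by rewrite setTI probability_setT mul1e.
have [x1|x1] := leP x 1; first by apply: key; rewrite x2.
have -> : E = Y i @^-1` [set y | (1%:E < y)%E].
  apply/seteqP; split=> w; rewrite /E/=.
    by apply: lt_trans; rewrite lte_fin.
  case: (rtp_valued hY i w) => [/andP[_ h]|->]; last by rewrite !ltry.
  by rewrite ltNge h.
by apply: key; lra.
Qed.

(** Peel off the vertices of the level one by one: for each of them, the tail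
    event intersected with events on the remaining vertices is shielded from all
    generations below it. *)
Lemma tail_independent_level (A : set T) n :
  (forall m, sY [set i : vertex | (m <= size i)%N] A) ->
  independent_sigma P (sY [set i : vertex | size i = n]) [set A].
Proof.
move=> tA; have mA : measurable A by exact: sigma_rv_measurable (tA 0%N).
rewrite sigma_rvE => E _ cE ->; move: E cE.
apply: (independent_generator cylinder_setI
  cylinder_measurable mA) => _ [s [B [sn mB ->]]].
have level_shielded i j m : size i = n -> size j = n -> i != j ->
  shielded i m j.
  move=> si sj ij v vm; apply/negP; rewrite prefixE take_size_cat ?si// =>
    /eqP ji.
  by rewrite ji eqxx in ij.
have tail_shielded i m : size i = n ->
  [set j : vertex | (n + m <= size j)%N] `<=` shielded i m.
  move=> si j /= nj v vm; apply/negP => /size_prefix;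
    rewrite size_cat si leqNgt.
  by rewrite (leq_trans _ nj)// ltn_add2l.
have -> : [set` s] = [set` undup s].
  by apply/seteqP; split=> i /=; rewrite mem_undup.
have {}sn i : i \in undup s -> size i = n by rewrite mem_undup; exact: sn.
have prodE (r : seq vertex) : uniq r -> (forall i, i \in r -> size i = n) ->
    P ((\bigcap_(i in [set` r]) Y i @^-1` B i) `&` A) =
    (\prod_(i <- r) P (Y i @^-1` B i) * P A)%E.
  elim: r => [|i r ih] /=;
    first by rewrite big_nil mul1e set_nil bigcap_set0 setTI.
  move=> /andP[ir ur] rn; rewrite big_cons.
  have -> : [set` i :: r] = i |` [set` r].
    by apply/seteqP; split=> j /=; rewrite inE;
      [move/predU1P|move=> h; apply/predU1P].
  rewrite bigcap_setU1 -setIA.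
  rewrite (@independent_of_shielded _ i _ (B i))//.
    by rewrite ih ?muleA// => j jr; apply: rn; rewrite inE jr orbT.
  have si : size i = n by apply: rn; rewrite mem_head.
  move=> m; apply: sigma_rv_setI; last by apply: sigma_rv_sub (tA (n + m)%N);
    exact: tail_shielded.
  rewrite sigma_rvE; apply: sub_sigma_algebra; exists r, B; split => // j jr.
  apply: level_shielded => //; first by apply: rn; rewrite inE jr orbT.
  by apply: contra ir => /eqP ->.
rewrite prodE ?undup_uniq//; congr (_ * _)%E.
by rewrite (rtp_indep hY (n := n)) ?undup_uniq.
Qed.

End tail_triviality.

Theorem theorem5 (R : realType) (d : measure_display) (T : measurableType d)
    (P : probability T R)
    (U : vertex -> {RV P >-> R}) (Y : vertex -> {RV P >-> \bar R})
    (hU : innovation_process P U)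
    (hY : invariant_rtp P frozen_I frozen_Phi frozen_nu U Y) :
  trivial_tail P Y.
Proof.
move=> A tA.
have tailA m : sigma_rv P [set i : vertex | (m <= size i)%N] Y A by exact: tA.
have mA : measurable A by exact: sigma_rv_measurable (tailA 0%N).
have allA : sigma_rv P setT Y A by apply: sigma_rv_sub (tailA 0%N).
have ind := independent_all (@measurable_frozen_Phi R) hU hY tailA
  (fun n => tail_independent_level hU hY (n := n) tailA).
have := ind A A allA erefl; rewrite setIid.
rewrite -[P A]fineK ?fin_num_measure// -EFinM => -[] e.
have /eqP : fine (P A) * (1 - fine (P A)) = 0 by rewrite mulrBr mulr1 -e subrr.
by rewrite mulf_eq0 subr_eq0 => /orP[/eqP ->|/eqP <-]; [left|right].
Qed.
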